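(* There is an absolute constant $C_1>0$ such that, writing $C_{1,\beta}=2^{-1/2}C_1(\beta^{-1}+1)$ for $\beta>0$, the following holds for $d=1$. Let $\alpha,\beta>0$ and $0<R_s\le\dfrac{\alpha^{1/8}}{2^{7/2}C_{1,\beta}^{1/4}}$. Then: (i) For each $f_-\in B(\frac{R_s}{2})$ there exist a unique $f_+\in B(2R_s)$ and a unique mild solution $f$ of the 6-wave kinetic equation such that $$\lim_{t\to\infty}\|T^{-t}f(t)-f_+\|_{\alpha,\beta}=0\quad\text{and}\quad\lim_{t\to-\infty}\|T^{-t}f(t)-f_-\|_{\alpha,\beta}=0.$$ (ii) For each $g_+\in B(\frac{R_s}{2})$ there exist a unique $g_-\in B(2R_s)$ and a unique mild solution $g$ of the 6-wave kinetic equation such that $$\lim_{t\to\infty}\|T^{-t}g(t)-g_+\|_{\alpha,\beta}=0\quad\text{and}\quad\lim_{t\to-\infty}\|T^{-t}g(t)-g_-\|_{\alpha,\beta}=0.$$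
   Context: Here $d=1$, $t\in\mathbb{R}$, $x,v\in\mathbb{R}^d$. ''Measurable'' means Borel measurable; functions of $(t,x,v)$ are jointly measurable. Spaces. $\mathcal{M}_{\alpha,\beta}$ is the space of measurable $g:\mathbb{R}^d\times\mathbb{R}^d\to\mathbb{R}$ with $\|g\|_{\alpha,\beta}:=\sup_{x,v}|g(x,v)|e^{\alpha|x|^2+\beta|v|^2}<\infty$. $L^\infty(\mathbb{R},\mathcal{M}_{\alpha,\beta})$ is the space of time-dependent functions $g(t,x,v)$ with $|||g|||_{\alpha,\beta}:=\sup_{t\in\mathbb{R}}\|g(t)\|_{\alpha,\beta}<\infty$. For $R>0$, $B(R)=\{g\in\mathcal{M}_{\alpha,\beta}:\|g\|_{\alpha,\beta}<R\}$. Transport. $(T^sg)(t,x,v):=g(t,x-sv,v)$. So $T^{-t}f(t)$ is the function $(x,v)\mapsto f(t,x+tv,v)$, and $T^{-s}\mathcal{C}_6[f](s,x,v)=\mathcal{C}_6[f](s,x+sv,v)$. Equation. The 6-wave kinetic equation with initial data $f_0$ is $\partial_tf+v\cdot\nabla_xf=\mathcal{C}_6[f]$, $f(t=0)=f_0$, where $$\mathcal{C}_6[f](t,x,v)=\int_{\mathbb{R}^{5d}}\delta(\Sigma)\delta(\Omega)\Big[f_3f_4f_5(ff_1+ff_2+f_1f_2)-ff_1f_2(f_3f_4+f_3f_5+f_4f_5)\Big]dv_1\cdots dv_5,$$ $f=f(t,x,v)$, $f_i=f(t,x,v_i)$, $\Sigma=v+v_1+v_2-v_3-v_4-v_5$,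 $\Omega=|v|^2+|v_1|^2+|v_2|^2-|v_3|^2-|v_4|^2-|v_5|^2$. Meaning of the deltas: $\delta(\Sigma)$ sets $v_5=v+v_1+v_2-v_3-v_4$; then, for fixed $v,v_1,v_2$, with $h(v_3,v_4)$ denoting $\Omega$ after this substitution, $\int_{\mathbb{R}^{2d}}\delta(h)F\,dv_3dv_4:=\int_{\{h=0\}}\frac{F}{|\nabla h|}\,d\mathcal{H}^{2d-1}$ (surface measure on the zero set of $h$ in $\mathbb{R}^{2d}$). Mild solution. For $f_0\in\mathcal{M}_{\alpha,\beta}$, a measurable $f:\mathbb{R}\times\mathbb{R}^d\times\mathbb{R}^d\to\mathbb{R}$ is a mild solution with initial data $f_0$ if $T^{-t}f(t)\in L^\infty(\mathbb{R},\mathcal{M}_{\alpha,\beta})$ and $T^{-t}f(t,x,v)=f_0(x,v)+\int_0^tT^{-s}\mathcal{C}_6[f](s,x,v)\,ds$ for all $t\in\mathbb{R}$. A mild solution of the equation (without mention of initial data) is a mild solution for some initial data $f_0\in\mathcal{M}_{\alpha,\beta}$. *)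

(* Defs.v *)
From HB Require Import structures.
From mathcomp Require Import all_boot all_order all_algebra.
From mathcomp Require Import all_classical all_reals all_analysis.
From mathcomp Require Import ring lra.

Set Implicit Arguments.
Unset Strict Implicit.
Unset Printing Implicit Defensive.

Import Order.TTheory GRing.Theory Num.Theory.
Import numFieldNormedType.Exports.

Local Open Scope classical_set_scope.
Local Open Scope ring_scope.

(* One-dimensional Hausdorff measure on the Euclidean plane.  The distance is
   spelled out because the norm that the library puts on R * R is the maximum
   norm, for which the Hausdorff measure of a curve is not its length. *)
Section hausdorff1.
Context {R : realType}.
Implicit Types (p q : R * R) (A B X Y : set (R * R)) (U : (set (R * R))^nat).

Definition edist p q : R :=
  Num.sqrt ((p.1 - q.1) ^+ 2 + (p.2 - q.2) ^+ 2).

(* 0 is added to the set so that the empty set has diameter 0, not -oo. *)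
Definition ediam A : \bar R :=
  ereal_sup (0%E |` [set (edist pq.1 pq.2)%:E | pq in A `*` A]).

Definition fine_cover (delta : R) A : set ((set (R * R))^nat) :=
  [set U | A `<=` \bigcup_i U i /\ forall i, (ediam (U i) <= delta%:E)%E].

Definition hausdorff1_pre (delta : R) A : \bar R :=
  ereal_inf [set (\sum_(0 <= i <oo) ediam (U i))%E | U in fine_cover delta A].

Definition hausdorff1 A : \bar R :=
  ereal_sup [set hausdorff1_pre delta A | delta in [set delta | 0 < delta]].

Lemma ediam_ge0 A : (0 <= ediam A)%E.
Proof. by apply: ereal_sup_ubound; left. Qed.

Lemma ediam0 : ediam set0 = 0%E.
Proof.
apply/eqP; rewrite eq_le ediam_ge0 andbT; apply: ge_ereal_sup => x [->//|].
by move=> [[p q] [Ap _] _].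
Qed.

Lemma edist_le_ediam A p q : A p -> A q -> ((edist p q)%:E <= ediam A)%E.
Proof. by move=> Ap Aq; apply: ereal_sup_ubound; right; exists (p, q). Qed.

Lemma edist_fst p q : `|p.1 - q.1| <= edist p q.
Proof. by rewrite -sqrtr_sqr /edist ler_wsqrtr// lerDl sqr_ge0. Qed.

Lemma edist_snd p q : `|p.2 - q.2| <= edist p q.
Proof. by rewrite -sqrtr_sqr /edist ler_wsqrtr// lerDr sqr_ge0. Qed.

Lemma hausdorff1_pre_ge0 d A : (0 <= hausdorff1_pre d A)%E.
Proof.
apply: le_ereal_inf_tmp => _ [U _ <-].
by apply: nneseries_ge0 => i _ _; exact: ediam_ge0.
Qed.

Lemma le_hausdorff1_pre d A B : A `<=` B ->
  (hausdorff1_pre d A <= hausdorff1_pre d B)%E.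
Proof.
move=> AB; apply: ereal_inf_le_tmp => _ [U [BU dU] <-].
by exists U => //; split => //; exact: subset_trans BU.
Qed.

Lemma hausdorff1_pre_anti d e A : d <= e ->
  (hausdorff1_pre e A <= hausdorff1_pre d A)%E.
Proof.
move=> de; apply: ereal_inf_le_tmp => _ [U [AU dU] <-].
exists U => //; split => // i; apply: (le_trans (dU i)).
by rewrite lee_fin.
Qed.

Lemma hausdorff1_pre0 d : 0 < d -> hausdorff1_pre d set0 = 0%E.
Proof.
move=> d0; apply/eqP; rewrite eq_le hausdorff1_pre_ge0 andbT.
apply: ereal_inf_lbound; exists (fun=> set0).
  by split => // i; rewrite ediam0 lee_fin ltW.
by rewrite eseries0// => i _ _; rewrite ediam0.
Qed.

Lemma hausdorff1_pre_sigma_subadditive d : sigma_subadditive (hausdorff1_pre d).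
Proof.
move=> A; have [[i ioo]|] := pselect (exists i, hausdorff1_pre d (A i) = +oo%E).
  rewrite (eseries_pinfty _ _ ioo) ?leey// => n _.
  by rewrite -ltNye (lt_le_trans _ (hausdorff1_pre_ge0 _ _)).
rewrite -forallNE => Aoo.
suff add2e (e : {posnum R}) : (hausdorff1_pre d (\bigcup_n A n) <=
    \sum_(i <oo) hausdorff1_pre d (A i) + e%:num%:E)%E.
  by apply/lee_addgt0Pr => _/posnumP[].
rewrite (le_trans _ (epsilon_trick _ _ _))//; last first.
  by move=> n; exact: hausdorff1_pre_ge0.
pose P n (B : (set (R * R))^nat) := fine_cover d (A n) B /\
  (\sum_(k <oo) ediam (B k) <=
   hausdorff1_pre d (A n) + (e%:num / (2 ^ n.+1)%:R)%:E)%E.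
have [G PG] : {G : ((set (R * R))^nat)^nat & forall n, P n (G n)}.
  apply: (@choice _ _ P) => n; rewrite /P /hausdorff1_pre.
  set S := (X in ereal_inf X); move infS : (ereal_inf S) => iS.
  case: iS infS => [r Sr|Soo|Soo].
  - have en1 : (0 < e%:num / (2 ^ n.+1)%:R) by [].
    have /(lb_ereal_inf_adherent en1) : ereal_inf S \is a fin_num by rewrite Sr.
    move=> [x [B cB muBx] xS].
    by exists B; split => //; rewrite muBx -Sr; exact/ltW.
  - by have := Aoo n; rewrite /hausdorff1_pre Soo.
  - suff : lbound S 0%E by move/le_ereal_inf_tmp; rewrite Soo.
    move=> /= _ [B _ <-]; apply: nneseries_ge0 => i _ _; exact: ediam_ge0.
have muG_ge0 x : (0 <= (ediam \o uncurry G) x)%E by exact: ediam_ge0.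
apply: (@le_trans _ _ (\esum_(i in setT) (ediam \o uncurry G) i)%E).
  rewrite /hausdorff1_pre; apply: ereal_inf_lbound => /=.
  have /card_esym/ppcard_eqP[f] := card_nat2.
  exists (uncurry G \o f).
    split => [|i]; last first.
      by rewrite /=; case: (f i) => a b; exact: (PG a).1.2.
    apply: (@subset_trans _ (\bigcup_n \bigcup_k G n k)) => [t [i _]|].
      by move=> /((PG i).1.1) -[j _ ?]; exists i => //; exists j.
    move=> t [i _ [j _ Bijt]]; exists (f^-1%FUN (i, j)) => //=.
    by rewrite invK ?inE.
  rewrite -(esum_pred_image (ediam \o uncurry G) _ xpredT) ?[fun=> _]set_true//.
  by rewrite image_eq.
rewrite (_ : esum _ _ = \sum_(i <oo) \sum_(j <oo) ediam (G i j))%E; last first.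
  pose J : nat -> set (nat * nat) := fun i => [set (i, j) | j in setT].
  rewrite (_ : setT = \bigcup_k J k); last first.
    by rewrite predeqE => -[a b]; split => // _; exists a => //; exists b.
  rewrite esum_bigcupT /=; last 2 first.
    - apply/trivIsetP => i j _ _ ij.
      rewrite predeqE => -[n m] /=; split => //= -[] [_] _ [<-{n} _].
      by move=> [m' _] [] /esym/eqP; rewrite (negbTE ij).
    - by move=> nm; exact: (muG_ge0 nm).
  rewrite -(image_id [set: nat]) -fun_true esum_pred_image//; last first.
    by move=> n _; apply: esum_ge0 => m _; exact: (muG_ge0 m).
  apply: eq_eseriesr => /= j _.
  rewrite -(esum_pred_image (ediam \o uncurry G) (pair j) predT)//=; last 2 first.
    - by move=> m _; exact: (muG_ge0 (j, m)).
    - by move=> ? ? _ _; exact: (@can_inj _ _ _ snd).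
  by congr esum; rewrite predeqE => -[a b]; split; move=> [i _ <-]; exists i.
apply: lee_nneseries => [n _ _|n _].
  by apply: nneseries_ge0 => m *; exact: ediam_ge0.
exact: (PG n).2.
Qed.

Lemma hausdorff1_pre_le d A : 0 < d -> (hausdorff1_pre d A <= hausdorff1 A)%E.
Proof. by move=> d0; apply: ereal_sup_ubound; exists d. Qed.

Lemma hausdorff1_ge0 A : (0 <= hausdorff1 A)%E.
Proof. exact: le_trans (hausdorff1_pre_ge0 1 A) (hausdorff1_pre_le _ _). Qed.

Lemma hausdorff10 : hausdorff1 set0 = 0%E.
Proof.
apply/eqP; rewrite eq_le hausdorff1_ge0 andbT; apply: ge_ereal_sup.
by move=> _ [d d0 <-]; rewrite hausdorff1_pre0.
Qed.

Lemma le_hausdorff1 : {homo hausdorff1 : A B / A `<=` B >-> (A <= B)%E}.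
Proof.
move=> A B AB; apply: ge_ereal_sup => _ [d d0 <-].
exact: le_trans (le_hausdorff1_pre d AB) (hausdorff1_pre_le _ _).
Qed.

Lemma hausdorff1_sigma_subadditive : sigma_subadditive hausdorff1.
Proof.
move=> A; apply: ge_ereal_sup => _ [d d0 <-].
apply: (le_trans (hausdorff1_pre_sigma_subadditive d A)).
apply: lee_nneseries => [i _ _|i _]; first exact: hausdorff1_pre_ge0.
exact: hausdorff1_pre_le.
Qed.

HB.instance Definition _ := isOuterMeasure.Build R (R * R)%type hausdorff1
  hausdorff10 hausdorff1_ge0 le_hausdorff1 hausdorff1_sigma_subadditive.

Lemma hausdorff1_metric (d : R) X Y : 0 < d ->
  (forall p q, X p -> Y q -> d <= edist p q) ->
  (hausdorff1 X + hausdorff1 Y <= hausdorff1 (X `|` Y))%E.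
Proof.
move=> d0 sep.
have pre (e : R) : 0 < e ->
    (hausdorff1_pre e X + hausdorff1_pre e Y <= hausdorff1 (X `|` Y))%E.
  move=> e0; pose e' := Num.min e (d / 2).
  have e'0 : 0 < e' by rewrite lt_min e0 divr_gt0.
  apply: le_trans (hausdorff1_pre_le _ e'0).
  apply: le_ereal_inf_tmp => _ [U [XYU dU] <-].
  pose V Z i := if pselect (U i `&` Z !=set0) then U i else set0.
  have VU Z i : (ediam (V Z i) <= ediam (U i))%E.
    by rewrite /V; case: pselect => [?|?]; rewrite ?ediam0 ?ediam_ge0.
  have cV Z : Z `<=` X `|` Y -> fine_cover e Z (V Z).
    move=> ZXY; split => [p Zp|i].
      have [i _ Uip] := XYU _ (ZXY _ Zp); exists i => //.
      by rewrite /V; case: pselect => // -[]; exists p.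
    apply: (le_trans (VU _ _)); apply: (le_trans (dU i)).
    by rewrite lee_fin ge_min lexx.
  apply: (@le_trans _ _ (\sum_(0 <= i <oo) ediam (V X i) +
                         \sum_(0 <= i <oo) ediam (V Y i))%E).
    apply: leeD; apply: ereal_inf_lbound.
      by exists (V X) => //; apply: cV; exact: subsetUl.
    by exists (V Y) => //; apply: cV; exact: subsetUr.
  rewrite -nneseriesD; try by move=> *; exact: ediam_ge0.
  apply: lee_nneseries => [i _ _|i _]; first by rewrite adde_ge0// ediam_ge0.
  rewrite /V; case: pselect => [[p [Up Xp]]|n1]; last first.
    by rewrite ediam0 add0e; exact: VU.
  case: pselect => [[q [Uq Yq]]|n2]; last by rewrite ediam0 adde0.
  have := le_trans (edist_le_ediam Up Uq) (dU i).
  rewrite lee_fin => h1; have h2 := sep _ _ Xp Yq.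
  have h3 : e' <= d / 2 by rewrite ge_min lexx orbT.
  suff : False by []; lra.
have [oo|] := eqVneq (hausdorff1 (X `|` Y)) +oo%E; first by rewrite oo leey.
move=> fXY.
have fin Z : Z `<=` X `|` Y -> hausdorff1 Z \is a fin_num.
  move=> ZXY; rewrite ge0_fin_numE ?hausdorff1_ge0//.
  by apply: le_lt_trans (le_hausdorff1 ZXY) _; rewrite ltey.
have fX := fin _ (@subsetUl _ X Y); have fY := fin _ (@subsetUr _ X Y).
rewrite -leeBrDr//; apply: ge_ereal_sup => _ [e1 /= e10 <-].
have fe1 : hausdorff1_pre e1 X \is a fin_num.
  rewrite ge0_fin_numE ?hausdorff1_pre_ge0//.
  apply: le_lt_trans (hausdorff1_pre_le X e10) _.
  by rewrite -ge0_fin_numE ?hausdorff1_ge0.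
rewrite leeBrDr// addeC -leeBrDr//; apply: ge_ereal_sup => _ [e2 /= e20 <-].
rewrite leeBrDr// addeC.
have m0 : 0 < Num.min e1 e2 by rewrite lt_min e10.
apply: le_trans (pre _ m0).
by apply: leeD; apply: hausdorff1_pre_anti; rewrite ge_min lexx ?orbT.
Qed.

Lemma hausdorff1_halfplane (phi : R * R -> R) (a : R) :
  (forall p q, `|phi p - phi q| <= edist p q) ->
  hausdorff1.-caratheodory [set p | phi p <= a].
Proof.
move=> lip; apply: le_caratheodory_measurable => E.
have [oo|finE] := eqVneq (hausdorff1 E) +oo%E; first by rewrite [leRHS]oo leey.
have sep X Y (c : R) : 0 < c -> (forall p q, X p -> Y q -> c <= phi q - phi p) ->
    (hausdorff1 X + hausdorff1 Y <= hausdorff1 (X `|` Y))%E.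
  move=> c0 XY; apply: (@hausdorff1_metric c) => // p q Xp Yq.
  apply: le_trans (XY _ _ Xp Yq) _; apply: le_trans (lip p q).
  by rewrite distrC ler_norm.
pose s (k : nat) : R := a + k.+1%:R^-1.
have s_dec m n : (m <= n)%N -> s n <= s m.
  by move=> mn; rewrite lerD2l lef_pV2 ?posrE// ler_nat.
have s_decs m n : (m < n)%N -> s n < s m.
  by move=> mn; rewrite ltrD2l ltf_pV2 ?posrE// ltr_nat.
pose B n := E `&` [set p | s n <= phi p].
pose A k := E `&` [set p | s k.+1 <= phi p < s k].
pose U j N := [set p | exists2 k, (k < N)%N & A (k.*2 + j)%N p].
have UE j N : U j N `<=` E by move=> p [k _ []].
have stepU j N : (hausdorff1 (U j N) + hausdorff1 (A (N.*2 + j)%N) <=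
                  hausdorff1 (U j N.+1))%E.
  have -> : U j N.+1 = A (N.*2 + j)%N `|` U j N.
    apply/seteqP; split => [p [k]|p [Ap|[k kN Ap]]].
    - rewrite ltnS leq_eqVlt => /predU1P[->|kN] Ap; first by left.
      by right; exists k.
    - by exists N.
    - by exists k => //; exact: ltnW.
  case: N => [|N].
    have -> : U j 0%N = set0 by apply/seteqP; split => // p [].
    by rewrite hausdorff10 add0e setU0.
  rewrite addeC; apply: (sep _ _ (s (N.+1.*2 + j).-1 - s (N.+1.*2 + j)%N)).
    by rewrite subr_gt0; apply: s_decs; rewrite doubleS addSn.
  move=> p q [_ /andP[_ pA]] [k kN [_ /andP[Aq _]]].
  apply: lerB; last exact: ltW.
  apply: le_trans Aq; apply: s_dec.
  by rewrite doubleS !addSn /= ltnS leq_add2r leq_double.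
have sumA N : (\sum_(0 <= k < N.*2) hausdorff1 (A k) <=
    hausdorff1 (U 0%N N) + hausdorff1 (U 1%N N))%E.
  elim: N => [|N IH]; first by rewrite big_geq// adde_ge0// hausdorff1_ge0.
  rewrite doubleS !big_nat_recr//=; apply: le_trans; last first.
    by apply: leeD; exact: stepU.
  rewrite addn0 addn1 addeACA; apply: le_trans (leeD2r _ IH).
  by rewrite addeA.
have sumAoo : (\sum_(0 <= k <oo) hausdorff1 (A k) < +oo)%E.
  apply: (@le_lt_trans _ _ (hausdorff1 E + hausdorff1 E)%E); last first.
    by rewrite lte_add_pinfty// ltey.
  apply: lime_le; first by apply: is_cvg_nneseries => *; exact: hausdorff1_ge0.
  near=> n; apply: (@le_trans _ _ (\sum_(0 <= k < n.*2) hausdorff1 (A k))%E).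
    rewrite [leRHS](@big_cat_nat _ _ _ n)//= -?addnn ?leq_addr// leeDl//.
    by apply: sume_ge0 => *; exact: hausdorff1_ge0.
  by apply: le_trans (sumA n) _; apply: leeD; exact: le_hausdorff1.
have tail := nneseries_tail_cvg sumAoo (fun k _ => hausdorff1_ge0 (A k)).
pose H := [set p | phi p <= a].
have key (n : nat) : (hausdorff1 (E `&` H) +
    hausdorff1 (E `&` ~` H) <=
    hausdorff1 E + \sum_(n <= k <oo) hausdorff1 (A k))%E.
  apply: (@le_trans _ _ (hausdorff1 (E `&` H) +
      (hausdorff1 (B n) + \sum_(n <= k <oo) hausdorff1 (A k)))%E).
    apply: leeD2l; apply: (@le_trans _ _ (hausdorff1
        (B n `|` \bigcup_(k in ~` `I_n) A k))); last first.
      apply: le_trans (outer_measureU2 _ _ _) _; apply: leeD2l.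
      exact: outer_measure_sigma_subadditive_tail.
    apply: le_hausdorff1 => p [Ep /negP]; rewrite -ltNge => ap.
    have [|pn] := leP (s n) (phi p); first by left.
    right; have ex : exists k, s k.+1 <= phi p.
      have [k /ltW kp] := ltr_add_invr ap; exists k.
      by apply: le_trans kp; apply/ltW/s_decs.
    have [k kp kmin] := ex_minnP ex.
    exists k; last first.
      split => //=; rewrite kp /=.
      case: k kmin {kp} => [|k] kmin; last first.
        by rewrite ltNge; apply/negP => /kmin; rewrite ltnn.
      by apply: lt_le_trans pn _; exact: s_dec.
    move=> /= kn; have := lt_le_trans pn (s_dec _ _ kn).
    by rewrite ltNge kp.
  rewrite addeA; apply: leeD2r.
  apply: (@le_trans _ _ (hausdorff1
      ((E `&` H) `|` B n))); last first.
    by apply: le_hausdorff1 => p [[]|[]].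
  apply: (sep _ _ (n.+1%:R^-1)); first by rewrite invr_gt0.
  move=> p q [_ pa] [_ qs].
  have {}pa : phi p <= a := pa; have {}qs : a + n.+1%:R^-1 <= phi q := qs.
  by rewrite lerBrDl; apply: le_trans qs; rewrite lerD2r.
have cvgE : (hausdorff1 E + \sum_(n <= k <oo) hausdorff1 (A k) @[n --> \oo]
             --> hausdorff1 E)%E.
  rewrite -[X in _ --> X]adde0; apply: cvgeD => //; last exact: cvg_cst.
  exact: fin_num_adde_defl.
have limE := cvg_lim (@ereal_hausdorff R) cvgE.
apply: (@le_trans _ _ (limn (fun n => hausdorff1 E +
    \sum_(n <= k <oo) hausdorff1 (A k))%E)); last by rewrite limE.
apply: lime_ge; first by apply/cvg_ex; eexists; exact: cvgE.
by apply: nearW => n; exact: key.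
Unshelve. all: by end_near. Qed.

Lemma measurable_hausdorff1_caratheodory A :
  measurable A -> hausdorff1.-caratheodory A.
Proof.
have half (phi : R * R -> R) : (forall p q, `|phi p - phi q| <= edist p q) ->
    forall B : set R, measurable B -> hausdorff1.-cara.-measurable (phi @^-1` B).
  move=> lip B mB.
  pose S := [set B : set R | hausdorff1.-cara.-measurable (phi @^-1` B)].
  suff : measurable `<=` S by apply.
  apply: smallest_sub => [|_ [[b c] _ <-]].
    split => [|C SC|F SF]; rewrite /S /=.
    - by rewrite preimage_set0; exact: measurable0.
    - by rewrite setTD preimage_setC; exact: measurableC.
    - by rewrite preimage_bigcup; exact: bigcupT_measurable.
  rewrite /S /= (_ : _ @^-1` _ =
      [set p | phi p <= c] `\` [set p | phi p <= b]); last first.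
    apply/seteqP; split => p /=; rewrite in_itv/=.
      by move=> /andP[bp pc]; split => //; apply/negP; rewrite -ltNge.
    by move=> [pc /negP]; rewrite -ltNge => ->.
  by apply: measurableD; exact: hausdorff1_halfplane.
suff : (measurable : set (set (R * R))) `<=` hausdorff1.-cara.-measurable by apply.
apply: smallest_sub.
  split => [|C SC|F SF]; first exact: measurable0.
    by rewrite setTD; exact: measurableC.
  exact: bigcupT_measurable.
move=> C [[B mB <-]|[B mB <-]]; rewrite setTI; apply: half => //.
  exact: edist_fst.
exact: edist_snd.
Qed.

Lemma hausdorff1_semi_sigma_additive :
  semi_sigma_additive (hausdorff1 : set (R * R) -> \bar R).
Proof.
move=> F mF tF mUF.
apply: (@caratheodory_measure_sigma_additive R (R * R)%type hausdorff1) => //.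
  by move=> i; exact: measurable_hausdorff1_caratheodory.
exact: measurable_hausdorff1_caratheodory.
Qed.

HB.instance Definition _ := isMeasure.Build _ (R * R)%type R hausdorff1
  hausdorff10 hausdorff1_ge0 hausdorff1_semi_sigma_additive.

End hausdorff1.

Section kinetic.
Context {R : realType}.

Notation leb := (@lebesgue_measure R).

(* |grad h| for h defined on the plane *)
Definition grad_norm (h : R * R -> R) (p : R * R) : R :=
  Num.sqrt (derive1 (fun y => h (y, p.2)) p.1 ^+ 2 +
            derive1 (fun y => h (p.1, y)) p.2 ^+ 2).

(* \int delta(h) F.  Since x / 0 = 0, critical points of h on [set h = 0]
   contribute 0; for h = Omega v v1 v2 such a point only exists when the zero
   set, an ellipse in general, degenerates to that point, which is null. *)
Definition delta_integral (h F : R * R -> R) : R :=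
  \int[hausdorff1]_(p in [set p | h p = 0]) (F p / grad_norm h p).

Definition v5 (v v1 v2 v3 v4 : R) : R := v + v1 + v2 - v3 - v4.

Definition Omega (v v1 v2 v3 v4 : R) : R :=
  v ^+ 2 + v1 ^+ 2 + v2 ^+ 2 - v3 ^+ 2 - v4 ^+ 2 - v5 v v1 v2 v3 v4 ^+ 2.

Definition six_wave (f f1 f2 f3 f4 f5 : R) : R :=
  f3 * f4 * f5 * (f * f1 + f * f2 + f1 * f2)
  - f * f1 * f2 * (f3 * f4 + f3 * f5 + f4 * f5).

Definition C6 (f : R -> R -> R -> R) (t x v : R) : R :=
  \int[(leb \x leb)%E]_w
    delta_integral
      (fun p => Omega v w.1 w.2 p.1 p.2)
      (fun p => six_wave (f t x v) (f t x w.1) (f t x w.2)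
                  (f t x p.1) (f t x p.2) (f t x (v5 v w.1 w.2 p.1 p.2))).

Definition transport (s : R) (g : R -> R -> R -> R) : R -> R -> R -> R :=
  fun t x v => g t (x - s * v) v.

Definition wnorm (alpha beta : R) (g : R -> R -> R) : \bar R :=
  ereal_sup [set (`|g p.1 p.2| *
                  expR (alpha * p.1 ^+ 2 + beta * p.2 ^+ 2))%:E | p in setT].

Definition wspace (alpha beta : R) : set (R -> R -> R) :=
  [set g | measurable_fun setT (fun p : R * R => g p.1 p.2) /\
           (wnorm alpha beta g < +oo)%E].

Definition wball (alpha beta r : R) : set (R -> R -> R) :=
  [set g | wspace alpha beta g /\ (wnorm alpha beta g < r%:E)%E].

Definition jointly_measurable (g : R -> R -> R -> R) : Prop :=
  measurable_fun setT (fun p : R * R * R => g p.1.1 p.1.2 p.2).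

(* L^infty(R, M_{alpha,beta}) *)
Definition Linfty_wspace (alpha beta : R) : set (R -> R -> R -> R) :=
  [set g | jointly_measurable g /\
     (ereal_sup [set wnorm alpha beta (g t) | t in setT] < +oo)%E].

(* \int_a^b with the usual sign convention when b < a *)
Definition oriented_integral (a b : R) (g : R -> R) : R :=
  if a <= b then \int[leb]_(s in `[a, b]) g s
  else - \int[leb]_(s in `[b, a]) g s.

Definition mild_solution_from (alpha beta : R) (f0 : R -> R -> R)
    (f : R -> R -> R -> R) : Prop :=
  [/\ wspace alpha beta f0,
      jointly_measurable f,
      Linfty_wspace alpha beta (fun t => transport (- t) f t) &
      forall t x v, transport (- t) f t x v =
        f0 x v + oriented_integral 0 t (fun s => transport (- s) (C6 f) s x v)].

Definition mild_solution (alpha beta : R) (f : R -> R -> R -> R) : Prop :=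
  exists f0, mild_solution_from alpha beta f0 f.

Definition scatters (alpha beta : R) (F : set_system R)
    (f : R -> R -> R -> R) (g : R -> R -> R) : Prop :=
  wnorm alpha beta (fun x v => transport (- t) f t x v - g x v) @[t --> F]
    --> 0%E.

Definition C1beta (C1 beta : R) : R := 2 `^ (- 2^-1) * C1 * (beta^-1 + 1).

End kinetic.

(* Main.v *)
Require Import Defs.
From mathcomp Require Import all_boot all_order all_algebra.
From mathcomp Require Import all_classical all_reals all_analysis.
From mathcomp Require Import ring lra measurable_realfun.

Set Implicit Arguments.
Unset Strict Implicit.
Unset Printing Implicit Defensive.

Import Order.TTheory GRing.Theory Num.Theory.
Import numFieldNormedType.Exports.

Local Open Scope classical_set_scope.
Local Open Scope ring_scope.

(* Write F(t) = T^{-t} f(t) and w(x,v) = exp(-(alpha x^2 + beta v^2)).  In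
   dimension one delta(Omega) lives, for fixed v, v1, v2, on a translated and
   dilated copy of the fixed ellipse 2a^2 + 2b^2 + 2ab = 1, and the weight
   1/|grad h| exactly compensates the dilation.  The (v3,v4)-integral is thus an
   integral over a fixed finite measure space, which gives joint measurability
   of C_6[f] by Fubini and a bound that is uniform in v, v1, v2.  By conservation
   of momentum and energy, w_3 w_4 w_5 = w w_1 w_2 along the transported weights,
   so each of the six quintic terms is at most |||F|||^5 w w_1 w_2, and the two
   remaining Gaussian integrals give at most w(x,v) times
   pi / (alpha t^2 + beta), which is integrable in time.  Hence
   F(t) = f_- + int_{-oo}^t N F is solved by Picard iteration, and uniqueness
   follows from a Gronwall argument with the weight exp(l K(t)), K being a
   primitive of pi / (alpha t^2 + beta).  Part (ii) is part (i) for the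
   time-reversed operator. *)

(** * Hausdorff measure of plane curves *)

Section hausdorff_estimates.
Context {R : realType}.
Implicit Types (p q c : R * R) (A B : set (R * R)).

(** One-dimensional Hausdorff measure on the plane is not sigma-finite, and the resonant curve moves
    with the velocities, so Tonelli says nothing about [delta_integral] as it is written. Pulling
    every curve back to one ellipse of finite length removes both difficulties, which is why scaling
    and finiteness of length are established at the outset. The length is never computed: it enters
    [C1] as the number [ellmass]. The factors 1/2 fit together as follows. Data of size at most
    [Rs / 2] and a Lipschitz factor at most 1/2 on the ball of radius [Rs] keep the iteration in
    that ball, and the state at the other end of time obeys the same bound [Rs]. Uniqueness is
    claimed among all mild solutions, whose bounds may exceed [Rs] by any amount. The integral map
    need not contract there in the plain norm; the exponential time weight, with [l] chosen after
    the bounds, restores the factor 1/2. The analysis of collisions and the analysis in time meet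
    only in the predicate [tame], which is stable under time reversal. *)

Lemma ediam_le A (d : R) : 0 <= d -> (forall p q, A p -> A q -> Defs.edist p q <= d) ->
  (ediam A <= d%:E)%E.
Proof.
move=> d0 Ad; apply: ge_ereal_sup => _ [->|[[p q] [/= Ap Aq] <-]].
  by rewrite lee_fin.
by rewrite lee_fin; exact: Ad.
Qed.

(** Cutting [[0, 1)] into [n.+1] equal intervals cuts [A] into slabs of [phi], each of diameter at
    most [L / n.+1]. The diameters add up to at most [L] however fine the cover. *)
Lemma hausdorff1_le_bilipschitz A (phi : R * R -> R) (L : R) : 0 <= L ->
  (forall p, A p -> 0 <= phi p < 1) ->
  (forall p q, A p -> A q -> Defs.edist p q <= L * `|phi p - phi q|) ->
  (hausdorff1 A <= L%:E)%E.
Proof.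
move=> L0 phi01 phiL; apply: ge_ereal_sup => _ [d /= d0 <-].
have [n nd] : exists n : nat, L / n.+1%:R <= d.
  exists (Num.trunc (L / d)).
  rewrite ler_pdivrMr// mulrC -ler_pdivrMr//.
  by have /andP[_ /ltW] := truncn_itv (divr_ge0 L0 (ltW d0)).
pose U (i : nat) := [set p | A p /\ i%:R <= n.+1%:R * phi p < i.+1%:R].
have n0 : 0 < n.+1%:R :> R by [].
have dU i : (ediam (U i) <= (L / n.+1%:R)%:E)%E.
  apply: ediam_le => [|p q [Ap pi] [Aq qi]]; first exact: divr_ge0.
  apply: le_trans (phiL _ _ Ap Aq) _; apply: ler_wpM2l => //.
  rewrite -(@ler_pM2l _ n.+1%:R)// divff ?gt_eqF// -[X in X * `|_|]gtr0_norm//.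
  rewrite -normrM mulrBr ler_norml.
  move: pi qi; rewrite -[i.+1]addn1 natrD => /andP[p1 p2] /andP[q1 q2].
  by apply/andP; split; lra.
have U0 i : (n.+1 <= i)%N -> U i = set0.
  move=> ni; rewrite -subset0 => p [Ap /andP[ip _]].
  have /andP[_ p1] := phi01 _ Ap.
  have : n.+1%:R <= i%:R :> R by rewrite ler_nat.
  move: ip; rewrite -(ltr_pM2l n0) mulr1 in p1.
  by move=> h1 h2; suff : False by []; lra.
apply: (@le_trans _ _ (\sum_(0 <= i <oo) ediam (U i))%E).
  apply: ereal_inf_lbound; exists U => //; split => [p Ap|i]; last first.
    by apply: le_trans (dU i) _; rewrite lee_fin.
  have /andP[p0 _] := phi01 _ Ap.
  exists (Num.trunc (n.+1%:R * phi p)) => //; split => //.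
  by apply: truncn_itv; rewrite mulr_ge0.
rewrite (@nneseries_split _ _ 0%N n.+1) => [|k _]; last exact: ediam_ge0.
rewrite [X in (_ + X)%E]eseries0 => [|i /= ni _]; last by rewrite U0// ediam0.
rewrite adde0 add0n; apply: (@le_trans _ _ (\sum_(0 <= i < n.+1) (L / n.+1%:R)%:E)%E).
  by apply: lee_sum => i _; exact: dU.
by rewrite sumEFin sumr_const_nat subn0 -(mulr_natr (L / _)) divfK ?gt_eqF.
Qed.

(** A cover of [A] at scale [d / r] is pushed forward to a cover of the image at scale [d]. Its
    pieces are first cut down to [A], because the Lipschitz bound holds only there. *)
Lemma hausdorff1_image_lipschitz A (psi : R * R -> R * R) (r : R) : 0 < r ->
  (forall p q, A p -> A q -> Defs.edist (psi p) (psi q) <= r * Defs.edist p q) ->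
  (hausdorff1 (psi @` A) <= r%:E * hausdorff1 A)%E.
Proof.
move=> r0 psir; apply: ge_ereal_sup => _ [d /= d0 <-].
apply: (@le_trans _ _ (r%:E * hausdorff1_pre (d / r) A)%E); last first.
  by rewrite lee_pmul2l//; apply: hausdorff1_pre_le; exact: divr_gt0.
rewrite -lee_pdivrMl//; apply: le_ereal_inf_tmp => _ [U [AU dU] <-].
rewrite lee_pdivrMl// -nneseriesZl => [|i _]; last exact: ediam_ge0.
have dpsi i : (ediam (psi @` (U i `&` A)) <= r%:E * ediam (U i))%E.
  apply: ge_ereal_sup => _ [->|[[_ _] [[p [Up Ap] <-] [q [Uq Aq] <-]] <-]].
    by rewrite mule_ge0 ?ediam_ge0// lee_fin ltW.
  apply: (@le_trans _ _ (r * Defs.edist p q)%:E); first by rewrite lee_fin psir.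
  by rewrite EFinM lee_pmul2l//; exact: edist_le_ediam.
apply: (@le_trans _ _ (\sum_(0 <= i <oo) ediam (psi @` (U i `&` A)))%E).
  apply: ereal_inf_lbound; exists (fun i => psi @` (U i `&` A)) => //; split.
    by move=> _ [p Ap <-]; have [i _ Uip] := AU _ Ap; exists i => //; exists p.
  move=> i; apply: le_trans (dpsi i) _.
  by rewrite -lee_pdivlMl// -EFinM mulrC; exact: dU.
by apply: lee_nneseries => [i _ _|i _]; [exact: ediam_ge0|exact: dpsi].
Qed.

Definition affine2 c (r : R) p : R * R := (c.1 + r * p.1, c.2 + r * p.2).

Lemma edist_affine2 c (r : R) p q : 0 <= r ->
  Defs.edist (affine2 c r p) (affine2 c r q) = r * Defs.edist p q.
Proof.
move=> r0; rewrite /Defs.edist /=.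
rewrite -[in RHS](ger0_norm r0) -sqrtr_sqr -sqrtrM ?sqr_ge0//.
congr Num.sqrt; ring.
Qed.

Lemma measurable_affine2 c (r : R) : measurable_fun setT (affine2 c r).
Proof.
apply: measurable_fun_pair; apply: measurable_funD => //=;
  by apply: measurable_funM => //=.
Qed.

Lemma hausdorff1_affine2 c (r : R) A : 0 < r ->
  hausdorff1 (affine2 c r @` A) = (r%:E * hausdorff1 A)%E.
Proof.
move=> r0; apply/eqP; rewrite eq_le; apply/andP; split.
  by apply: hausdorff1_image_lipschitz => // p q _ _; rewrite edist_affine2// ltW.
(* The reverse inequality is the Lipschitz bound for the inverse similarity, with center [c'] and
   ratio [r^-1]. *)
rewrite -lee_pdivlMl//; pose c' := (- (r^-1 * c.1), - (r^-1 * c.2)).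
have AE : A = affine2 c' r^-1 @` (affine2 c r @` A).
  rewrite image_comp [X in X @` _](_ : _ = id) ?image_id//.
  apply/funext => -[a b]; rewrite /affine2/=.
  by congr pair; field; rewrite gt_eqF.
rewrite {1}AE; apply: hausdorff1_image_lipschitz; first by rewrite invr_gt0.
by move=> p q _ _; rewrite edist_affine2// invr_ge0 ltW.
Qed.

End hausdorff_estimates.

Section ellipse.
Context {R : realType}.
Implicit Types (p q c : R * R).

(** This is [a^2 + b^2 + (a + b)^2]: if [a] and [b] are the deviations of [v3] and [v4] from the
    mean of [v3, v4, v5], then [-(a + b)] is that of [v5], and the form is the sum of the three
    squares. *)
Definition ellq p : R := 2 * p.1 ^+ 2 + 2 * p.2 ^+ 2 + 2 * p.1 * p.2.

Definition ellipse : set (R * R) := [set p | ellq p = 1].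

(** The Euclidean norm of the gradient of [ellq]. *)
Definition ellgrad p : R :=
  Num.sqrt ((4 * p.1 + 2 * p.2) ^+ 2 + (4 * p.2 + 2 * p.1) ^+ 2).

Lemma measurable_ellq : measurable_fun setT ellq.
Proof.
by apply: measurable_funD; [apply: measurable_funD|];
  repeat (apply: measurable_funM => //=); exact: measurable_funX.
Qed.

Lemma measurable_ellipse : measurable ellipse.
Proof.
have -> : ellipse = setT `&` ellq @^-1` [set 1] by rewrite setTI.
exact: measurable_ellq.
Qed.

(** The square of [ellgrad p] equals [4 * ellq p + 12 * (p.1 + p.2)^2]. *)
Lemma ellgrad_ge2 p : ellipse p -> 2 <= ellgrad p.
Proof.
rewrite /ellipse /ellq /= => p1.
rewrite -[leLHS]ger0_norm// -sqrtr_sqr ler_wsqrtr//.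
have := sqr_ge0 (p.1 + p.2); nra.
Qed.

Lemma measurable_ellgrad : measurable_fun setT ellgrad.
Proof.
have msqrt := continuous_measurable_fun (@sqrt_continuous R).
rewrite /ellgrad; apply: (measurableT_comp msqrt).
by apply: measurable_funD; apply: measurable_funX; apply: measurable_funD;
  exact: measurable_funM.
Qed.

Definition ellipse_quarter (s1 s2 : R) : set (R * R) :=
  [set p | ellipse p /\ 0 <= s1 * (p.1 + p.2) /\ 0 <= s2 * (p.1 - p.2)].

(* On a quarter [s1 u, s2 d >= 0] of the ellipse, where [u = a + b] and
   [d = a - b], the coordinate [s1 u] is a decreasing function of [s2 d], so
   distances are controlled by increments of [s1 u - s2 d]. *)
Lemma hausdorff1_ellipse_quarter (s1 s2 : R) : s1 ^+ 2 = 1 -> s2 ^+ 2 = 1 ->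
  (hausdorff1 (ellipse_quarter s1 s2) <= 4%:E)%E.
Proof.
move=> s11 s21.
(* With [u] and [d] standing for the signed sum and difference, the ellipse is [3 u^2 + d^2 = 2], so
   [0 <= u <= 1] and [0 <= d <= 2] on the quarter. Adding 2 and dividing by 4 brings [u - d] into
   [[0, 1)]. *)
apply: (@hausdorff1_le_bilipschitz _ _
  (fun p => (s1 * (p.1 + p.2) - s2 * (p.1 - p.2) + 2) / 4)) => // [p|p q].
  rewrite /ellipse_quarter /ellipse /ellq /= => -[E1 [u0 d0]].
  have e : 3 * (s1 * (p.1 + p.2)) ^+ 2 + (s2 * (p.1 - p.2)) ^+ 2 = 2.
    by rewrite !exprMn s11 s21; lra.
  move: (s1 * _) (s2 * _) u0 d0 e => u d u0 d0 e.
  have d2 : d <= 2 by nra.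
  have u1 : u <= 1 by nra.
  by apply/andP; split; lra.
rewrite /ellipse_quarter /ellipse /ellq /= => -[Ep [up dp]] [Eq [uq dq]].
rewrite -[X in X * _](@ger0_norm _ 4)// -normrM /Defs.edist -sqrtr_sqr ler_wsqrtr//.
set u := s1 * _ in up *; set d := s2 * _ in dp *.
set u' := s1 * _ in uq *; set d' := s2 * _ in dq *.
have e : 3 * u ^+ 2 + d ^+ 2 = 2 by rewrite !exprMn s11 s21; lra.
have e' : 3 * u' ^+ 2 + d' ^+ 2 = 2 by rewrite !exprMn s11 s21; lra.
have -> : (p.1 - q.1) ^+ 2 + (p.2 - q.2) ^+ 2 = ((u - u') ^+ 2 + (d - d') ^+ 2) / 2.
  rewrite (_ : u - u' = s1 * (p.1 + p.2 - q.1 - q.2)); last by rewrite /u /u'; ring.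
  rewrite (_ : d - d' = s2 * (p.1 - p.2 - q.1 + q.2)); last by rewrite /d /d'; ring.
  by rewrite !exprMn s11 s21; field.
rewrite (_ : 4 * _ = (u - u') - (d - d')); last by field.
move: u d u' d' up dp uq dq e e' => u d u' d' up dp uq dq e e'.
(* When the two increments have opposite signs, the square of their difference is at least the sum
   of their squares. *)
suff : (u - u') * (d - d') <= 0.
  by have := sqr_ge0 (u - u'); have := sqr_ge0 (d - d'); nra.
rewrite leNgt; apply/negP => ud.
have key (a b a' b' : R) : 0 <= a -> 0 <= b -> a < a' -> b <= b' ->
    3 * a ^+ 2 + b ^+ 2 = 2 -> 3 * a' ^+ 2 + b' ^+ 2 = 2 -> False.
  move=> a0 b0 aa' bb' h h'.
  have : 0 < (a' - a) * (a' + a) by rewrite mulr_gt0//; lra.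
  have : 0 <= (b' - b) * (b' + b) by rewrite mulr_ge0//; lra.
  by nra.
have [uu'|uu'|uu'] := ltgtP u u'; last by rewrite uu' subrr mul0r ltxx in ud.
  apply: (key u d u' d') => //; rewrite leNgt; apply/negP => d'd; nra.
apply: (key u' d' u d) => //; rewrite leNgt; apply/negP => d'd; nra.
Qed.

Lemma hausdorff1_ellipse : (hausdorff1 ellipse < +oo)%E.
Proof.
pose A := ellipse_quarter.
have sub : ellipse `<=` (A 1 1 `|` A 1 (-1)) `|` (A (-1) 1 `|` A (-1) (-1)).
  move=> p Ep; have [u|u] := leP 0 (p.1 + p.2); have [d|d] := leP 0 (p.1 - p.2).
  - by left; left; split => //; split; lra.
  - by left; right; split => //; split; lra.
  - by right; left; split => //; split; lra.
  - by right; right; split => //; split; lra.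
apply: le_lt_trans (le_hausdorff1 sub) _.
have A4 s1 s2 : s1 ^+ 2 = 1 -> s2 ^+ 2 = 1 -> (hausdorff1 (A s1 s2) <= 4%:E)%E.
  exact: hausdorff1_ellipse_quarter.
have N1 : (-1) ^+ 2 = 1 :> R by rewrite sqrrN expr1n.
apply: (@le_lt_trans _ _ ((4%:E + 4%:E) + (4%:E + 4%:E))%E); last by rewrite -!EFinD ltry.
apply: le_trans (outer_measureU2 _ _ _) _; apply: leeD;
  apply: le_trans (outer_measureU2 _ _ _) _; apply: leeD; apply: A4; rewrite ?expr1n//.
Qed.

End ellipse.

(** * Integrals on the resonant ellipse *)

Section parametric_integral.
Context d1 d2 (T1 : measurableType d1) (T2 : measurableType d2) (R : realType).

(** Measurability of Tonelli sections is a hypothesis so that one proof serves both a sigma-finite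
    measure and a product measure treated by iterated integration. The real integral is [fine] of a
    difference of two nonnegative integrals, and this expression stays measurable in the parameter
    even where those integrals are infinite. *)
Lemma measurable_fun_Rintegral_tonelli (m2 : {measure set T2 -> \bar R})
    (D : set T2) (f : T1 -> T2 -> R) :
  (forall g : T1 * T2 -> \bar R, measurable_fun setT g -> (forall z, 0 <= g z)%E ->
    measurable_fun setT (fubini_F m2 g)) ->
  measurable D -> measurable_fun setT (fun z : T1 * T2 => f z.1 z.2) ->
  measurable_fun setT (fun x => \int[m2]_(y in D) f x y).
Proof.
move=> tonelli mD mf; pose g (z : T1 * T2) := (f z.1 z.2 * \1_D z.2)%:E.
have mg : measurable_fun setT g.
  apply/measurable_EFinP; apply: measurable_funM => //.
  by apply: measurableT_comp => //; exact: measurable_indic.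
rewrite [X in measurable_fun _ X](_ : _ =
    fine \o (fubini_F m2 g^\+ \- fubini_F m2 g^\-)%E).
  apply: measurableT_comp; first exact: (fine_measurable measurableT).
  apply: emeasurable_funB; apply: tonelli => //.
    exact: measurable_funepos.
  exact: measurable_funeneg.
apply/funext => x /=; rewrite Rintegral_mkcond /Rintegral integralE.
have E : (fun y => ((f x) \_ D y)%:E) = (fun y => g (x, y)).
  apply/funext => y; rewrite /g patchE indicE /=.
  by case: (y \in D); rewrite ?mulr1 ?mulr0.
rewrite /fubini_F E; congr (fine (_ - _)); apply: eq_integral => y _.
  by rewrite !funeposE.
by rewrite !funenegE.
Qed.

Lemma measurable_fun_Rintegral (m2 : {sigma_finite_measure set T2 -> \bar R})
    (D : set T2) (f : T1 -> T2 -> R) :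
  measurable D -> measurable_fun setT (fun z : T1 * T2 => f z.1 z.2) ->
  measurable_fun setT (fun x => \int[m2]_(y in D) f x y).
Proof.
apply: measurable_fun_Rintegral_tonelli => g mg g0.
exact: measurable_fun_fubini_tonelli_F.
Qed.

End parametric_integral.

(** The product is reassociated as [(T * T1) * T2], so that the two variables are integrated out one
    at a time, each against a sigma-finite measure. *)
Lemma measurable_fun_Rintegral_prod d d1 d2 (T : measurableType d)
    (T1 : measurableType d1) (T2 : measurableType d2) (R : realType)
    (m1 : {sigma_finite_measure set T1 -> \bar R})
    (m2 : {sigma_finite_measure set T2 -> \bar R}) (f : T -> T1 * T2 -> R) :
  measurable_fun setT (fun z : T * (T1 * T2) => f z.1 z.2) ->
  measurable_fun setT (fun x => \int[(m1 \x m2)%E]_w f x w).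
Proof.
apply: measurable_fun_Rintegral_tonelli => // g mg g0.
pose h (z : (T * T1) * T2) := g (z.1.1, (z.1.2, z.2)).
have mh : measurable_fun setT h.
  apply: measurableT_comp => //; apply: measurable_fun_pair.
    exact: measurableT_comp.
  by apply: measurable_fun_pair => //; exact: measurableT_comp.
have h0 z : (0 <= h z)%E by exact: g0.
rewrite (_ : fubini_F _ _ = fubini_F m1 (fubini_F m2 h)).
  apply: measurable_fun_fubini_tonelli_F => [|z].
    exact: measurable_fun_fubini_tonelli_F.
  by apply: integral_ge0 => y _; exact: h0.
apply/funext => x; rewrite /fubini_F fubini_tonelli1//.
exact: (measurableT_comp mg (pair1_measurable x)).
Qed.

Section ellipse_measure.
Context {R : realType}.
Implicit Types (p q c : R * R) (A B : set (R * R)).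

Definition ellm : {finite_measure set (R * R)%type -> \bar R} :=
  mfrestr (@measurable_ellipse R) (@hausdorff1_ellipse R).

Lemma ge0_integral_hausdorff1_affine2 c (r : R) A (f : R * R -> \bar R) : 0 < r ->
  measurable A -> measurable_fun setT f -> (forall p, (0 <= f p)%E) ->
  (\int[hausdorff1]_(p in affine2 c r @` A) f p =
   \int[hausdorff1]_(p in A) (r%:E * f (affine2 c r p)))%E.
Proof.
move=> r0 mA mf f0.
pose c' := (- (r^-1 * c.1), - (r^-1 * c.2)).
have K1 : cancel (affine2 c r) (affine2 c' r^-1).
  by move=> [a b]; rewrite /affine2/=; congr pair; field; rewrite gt_eqF.
have K2 : cancel (affine2 c' r^-1) (affine2 c r).
  by move=> [a b]; rewrite /affine2/=; congr pair; field; rewrite gt_eqF.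
have imE B : affine2 c r @` B = affine2 c' r^-1 @^-1` B.
  apply/seteqP; split => [_ [q Bq <-] /=|q /= Bq]; first by rewrite K1.
  by exists (affine2 c' r^-1 q).
have preE B : affine2 c r @^-1` (affine2 c r @` B) = B.
  have K : affine2 c' r^-1 \o affine2 c r = id by apply/funext => p /=; rewrite K1.
  by rewrite imE -comp_preimage K.
have mim B : measurable B -> measurable (affine2 c r @` B).
  move=> mB; rewrite imE -[X in measurable X]setTI.
  exact: (measurable_affine2 c' r^-1).
have mphi := measurable_affine2 c r.
have mfphi : measurable_fun A (f \o affine2 c r).
  by apply: measurable_funTS; exact: measurableT_comp.
pose rn : {nonneg R} := NngNum (ltW r0).
(* Since a similarity of ratio [r] multiplies length by [r], the measure [hausdorff1] is the image
   under it of [r] times itself. *)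
rewrite (eq_measure_integral (pushforward (mscale rn hausdorff1) (affine2 c r))); last first.
  move=> B mB _; rewrite /pushforward/= /mscale/=.
  transitivity (hausdorff1 (affine2 c r @` (affine2 c r @^-1` B))); last first.
    exact: hausdorff1_affine2.
  have K : affine2 c r \o affine2 c' r^-1 = id by apply/funext => p /=; rewrite K2.
  by rewrite imE -comp_preimage K.
rewrite (@ge0_integral_pushforward _ _ _ _ _ _ mphi _ _ f (mim _ mA)
  (measurable_funTS mf)) => [|p _]; last exact: f0.
rewrite preE ge0_integral_mscale// => [|p _]; last exact: f0.
by rewrite ge0_integralZl// lee_fin ltW.
Qed.

Lemma integral_hausdorff1_affine2 c (r : R) A (f : R * R -> \bar R) : 0 < r ->
  measurable A -> measurable_fun setT f ->
  (\int[hausdorff1]_(p in affine2 c r @` A) f p =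
   \int[hausdorff1]_(p in A) (r%:E * f (affine2 c r p)))%E.
Proof.
move=> r0 mA mf; rewrite integralE [RHS]integralE.
rewrite !ge0_integral_hausdorff1_affine2//.
- congr (_ - _)%E; apply: eq_integral => p _.
  + by rewrite (ge0_funeposM (f \o affine2 c r) (ltW r0)) !funeposE.
  + by rewrite (ge0_funenegM (f \o affine2 c r) (ltW r0)) !funenegE.
- exact: measurable_funeneg.
- exact: measurable_funepos.
Qed.

End ellipse_measure.

Lemma measurable_fun_ge0_inv d (T : measurableType d) (R : realType) (f : T -> R) :
  measurable_fun setT f -> (forall x, 0 <= f x) ->
  measurable_fun setT (fun x => (f x)^-1).
Proof.
move=> mf f0; rewrite (_ : (fun _ => _) = (fun x => f x `^ (- 1))).
  exact: (measurableT_comp (measurable_powR _)).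
by apply/funext => x; rewrite powRN powRr1.
Qed.

Section delta_integral.
Context {R : realType}.
Implicit Types (v : R) (w p q : R * R).

(** The mean of the three incoming velocities. Conservation of momentum makes it the mean of the
    outgoing ones too, hence the center of the resonant ellipse. *)
Definition ctr v w : R := (v + w.1 + w.2) / 3.

(** The square of this number is the sum of the squared deviations of [v], [w.1] and [w.2] from
    [ctr v w]. Conservation of energy says that the outgoing deviations have the same sum of
    squares. *)
Definition rad v w : R :=
  Num.sqrt (v ^+ 2 + w.1 ^+ 2 + w.2 ^+ 2 - (v + w.1 + w.2) ^+ 2 / 3).

Definition onell v w : R * R -> R * R := affine2 (ctr v w, ctr v w) (rad v w).

Lemma rad_sqr v w :
  rad v w ^+ 2 = v ^+ 2 + w.1 ^+ 2 + w.2 ^+ 2 - (v + w.1 + w.2) ^+ 2 / 3.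
Proof.
rewrite sqr_sqrtr//.
have := sqr_ge0 (v - w.1); have := sqr_ge0 (v - w.2).
have := sqr_ge0 (w.1 - w.2); nra.
Qed.

Lemma Omega_ellq v w p : Omega v w.1 w.2 p.1 p.2 =
  rad v w ^+ 2 - ellq (p.1 - ctr v w, p.2 - ctr v w).
Proof. by rewrite rad_sqr /Omega /v5 /ellq /ctr/=; field. Qed.

Lemma derive1_quadratic (a b c x : R) :
  derive1 (fun y : R => a + b * y + c * y ^+ 2) x = b + 2 * c * x.
Proof.
rewrite derive1E; apply: derive_val.
by apply: is_derive_eq; rewrite /GRing.scale/=; ring.
Qed.

Lemma grad_norm_Omega v w p :
  grad_norm (fun p => Omega v w.1 w.2 p.1 p.2) p =
  ellgrad (p.1 - ctr v w, p.2 - ctr v w).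
Proof.
rewrite /grad_norm /=.
pose S := v + w.1 + w.2.
rewrite (_ : (fun y => _) = fun y => (v ^+ 2 + w.1 ^+ 2 + w.2 ^+ 2 - p.2 ^+ 2 -
  (S - p.2) ^+ 2) + (2 * (S - p.2)) * y + (- 2) * y ^+ 2); last first.
  by apply/funext => y; rewrite /Omega /v5 /S; ring.
rewrite (_ : (fun y => Omega _ _ _ p.1 y) = fun y => (v ^+ 2 + w.1 ^+ 2 +
  w.2 ^+ 2 - p.1 ^+ 2 - (S - p.1) ^+ 2) + (2 * (S - p.1)) * y + (- 2) * y ^+ 2);
  last by apply/funext => y; rewrite /Omega /v5 /S; ring.
rewrite !derive1_quadratic /ellgrad /= /ctr -/S; congr Num.sqrt.
by field.
Qed.

Lemma delta_integral_Omega v w (F : R * R -> R) : measurable_fun setT F ->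
  delta_integral (fun p => Omega v w.1 w.2 p.1 p.2) F =
  \int[ellm]_(u in ellipse) ((rad v w != 0)%:R * (F (onell v w u) / ellgrad u)).
Proof.
move=> mF; pose h p := Omega v w.1 w.2 p.1 p.2; rewrite /delta_integral -/h.
(* If [rad] vanishes, the zero set of [h] is the single point [(ctr v w, ctr v w)], where the
   gradient is 0 and division by 0 returns 0. This is the origin of the indicator on the right-hand
   side. *)
have [r0|r0] := eqVneq (rad v w) 0.
  rewrite (@eq_Rintegral _ _ _ _ _ (cst 0)) => [|p]; last first.
    rewrite inE /= /h grad_norm_Omega Omega_ellq r0 expr0n sub0r => /eqP.
    rewrite oppr_eq0 => /eqP q0.
    rewrite /ellgrad [X in Num.sqrt X](_ : _ =
      10 * ellq (p.1 - ctr v w, p.2 - ctr v w) + 12 * ((p.1 - ctr v w) * (p.2 - ctr v w))); last by rewrite /ellq /=; ring.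
    move: q0; rewrite /ellq/=; move: (p.1 - _) (p.2 - _) => a b q0.
    have a0 : a = 0 by have := sqr_ge0 (a + b); have := sqr_ge0 b; nra.
    have b0 : b = 0 by move: q0; rewrite a0; nra.
    by rewrite a0 b0 !(mulr0, expr0n, addr0, mul0r) sqrtr0 invr0 mulr0.
  rewrite [RHS](@eq_Rintegral _ _ _ _ _ (cst 0)) => [|p _]; last by rewrite /= mul0r.
  by rewrite /Rintegral !integral0.
have rp : 0 < rad v w by rewrite lt_def r0 sqrtr_ge0.
have -> : [set p | h p = 0] = onell v w @` ellipse.
  apply/seteqP; split => [p /=|_ [u /= u1 <-]]; rewrite /h Omega_ellq.
    move=> /eqP; rewrite subr_eq0 => /eqP hp.
    exists ((p.1 - ctr v w) / rad v w, (p.2 - ctr v w) / rad v w).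
      by rewrite /ellipse /=; apply: (mulfI (x := rad v w ^+ 2));
        rewrite ?expf_neq0// [in RHS]hp /ellq/=; field.
    by rewrite /onell /affine2 /=; case: p {hp} => a b /=; congr pair; field.
  rewrite /onell /affine2/= -[X in X - _]mulr1 -{1}u1 /ellq/=; ring.
have mh : measurable_fun setT (grad_norm h).
  rewrite (_ : grad_norm h = ellgrad \o affine2 (- ctr v w, - ctr v w) 1).
    by apply: measurableT_comp; [exact: measurable_ellgrad|exact: measurable_affine2].
  apply/funext => p; rewrite grad_norm_Omega /affine2/=; congr ellgrad.
  by congr pair; ring.
rewrite /Rintegral integral_hausdorff1_affine2//; last 2 first.
- exact: measurable_ellipse.
- apply/measurable_EFinP; apply: measurable_funM => //.
  by apply: measurable_fun_ge0_inv => // p; exact: sqrtr_ge0.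
congr fine; rewrite [RHS](@eq_measure_integral _ _ _ _ hausdorff1) => [|A mA AE].
  apply: eq_integral => u; rewrite inE => Eu; rewrite -EFinM; congr EFin.
  rewrite mul1r grad_norm_Omega /onell.
  have -> : ellgrad ((affine2 (ctr v w, ctr v w) (rad v w) u).1 - ctr v w,
      (affine2 (ctr v w, ctr v w) (rad v w) u).2 - ctr v w) = rad v w * ellgrad u.
    rewrite /ellgrad /affine2/= -[in RHS](gtr0_norm rp) -sqrtr_sqr -sqrtrM ?sqr_ge0//.
    by congr Num.sqrt; ring.
  have := ellgrad_ge2 Eu => g2; field.
  by rewrite r0 gt_eqF//; lra.
by rewrite /ellm/= /mfrestr /mrestr; congr hausdorff1; apply/setIidl.
Qed.

End delta_integral.

(** * Measurability of the collision operator *)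

Section collision_measurable.
Context {R : realType}.
Implicit Types (f g : R -> R -> R -> R).

Lemma jointly_measurable_comp d (T : measurableType d) f (a b c : T -> R) :
  jointly_measurable f -> measurable_fun setT a -> measurable_fun setT b ->
  measurable_fun setT c -> measurable_fun setT (fun y => f (a y) (b y) (c y)).
Proof.
move=> mf ma mb mc.
exact: (measurableT_comp mf
  (measurable_fun_pair (measurable_fun_pair ma mb) mc)).
Qed.

(* The first factor is 0 exactly when [v = w.1 = w.2], where the resonant ellipse
   degenerates to a critical point of [Omega]. *)
Definition collision f (t x v : R) (w u : R * R) : R :=
  (rad v w != 0)%:R *
  (six_wave (f t x v) (f t x w.1) (f t x w.2) (f t x (onell v w u).1)
     (f t x (onell v w u).2)
     (f t x (v5 v w.1 w.2 (onell v w u).1 (onell v w u).2)) / ellgrad u).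

Lemma measurable_six_wave d (T : measurableType d) (a b c a' b' c' : T -> R) :
  measurable_fun setT a -> measurable_fun setT b -> measurable_fun setT c ->
  measurable_fun setT a' -> measurable_fun setT b' -> measurable_fun setT c' ->
  measurable_fun setT (fun y => six_wave (a y) (b y) (c y) (a' y) (b' y) (c' y)).
Proof.
move=> ma mb mc ma' mb' mc'; rewrite /six_wave.
by apply: measurable_funB; repeat (apply: measurable_funM => //);
  repeat (apply: measurable_funD => //); exact: measurable_funM.
Qed.

Lemma measurable_v5 d (T : measurableType d) (a b c a' b' : T -> R) :
  measurable_fun setT a -> measurable_fun setT b -> measurable_fun setT c ->
  measurable_fun setT a' -> measurable_fun setT b' ->
  measurable_fun setT (fun y => v5 (a y) (b y) (c y) (a' y) (b' y)).
Proof.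
move=> ma mb mc ma' mb'; rewrite /v5.
by repeat (apply: measurable_funB => //); repeat (apply: measurable_funD => //).
Qed.

Lemma measurable_rad d (T : measurableType d) (a : T -> R) (w : T -> R * R) :
  measurable_fun setT a -> measurable_fun setT w ->
  measurable_fun setT (fun y => rad (a y) (w y)).
Proof.
move=> ma mw; have msqrt := continuous_measurable_fun (@sqrt_continuous R).
rewrite /rad; apply: (measurableT_comp msqrt).
have m1 : measurable_fun setT (fun y => (w y).1) by exact: measurableT_comp.
have m2 : measurable_fun setT (fun y => (w y).2) by exact: measurableT_comp.
apply: measurable_funB; last first.
  apply: measurable_funM => //; apply: measurable_funX.
  by repeat (apply: measurable_funD => //).
by repeat (apply: measurable_funD => //); exact: measurable_funX.
Qed.

Lemma measurable_onell d (T : measurableType d) (a : T -> R) (w u : T -> R * R) :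
  measurable_fun setT a -> measurable_fun setT w -> measurable_fun setT u ->
  measurable_fun setT (fun y => onell (a y) (w y) (u y)).
Proof.
move=> ma mw mu.
have m1 : measurable_fun setT (fun y => (w y).1) by exact: measurableT_comp.
have m2 : measurable_fun setT (fun y => (w y).2) by exact: measurableT_comp.
have m3 : measurable_fun setT (fun y => (u y).1) by exact: measurableT_comp.
have m4 : measurable_fun setT (fun y => (u y).2) by exact: measurableT_comp.
have mc : measurable_fun setT (fun y => ctr (a y) (w y)).
  apply: measurable_funM => //; by repeat (apply: measurable_funD => //).
rewrite /onell /affine2/=; apply: measurable_fun_pair; apply: measurable_funD => //;
  apply: measurable_funM => //; exact: measurable_rad.
Qed.

Lemma measurable_collision d (T : measurableType d) f (a b c : T -> R)
    (w u : T -> R * R) : jointly_measurable f ->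
  measurable_fun setT a -> measurable_fun setT b -> measurable_fun setT c ->
  measurable_fun setT w -> measurable_fun setT u ->
  measurable_fun setT (fun y => collision f (a y) (b y) (c y) (w y) (u y)).
Proof.
move=> mf ma mb mc mw mu.
have m1 : measurable_fun setT (fun y => (w y).1) by exact: measurableT_comp.
have m2 : measurable_fun setT (fun y => (w y).2) by exact: measurableT_comp.
have mo := measurable_onell mc mw mu.
have m3 : measurable_fun setT (fun y => (onell (c y) (w y) (u y)).1).
  exact: (measurableT_comp _ mo).
have m4 : measurable_fun setT (fun y => (onell (c y) (w y) (u y)).2).
  exact: (measurableT_comp _ mo).
apply: measurable_funM.
  rewrite (_ : (fun _ => _) = \1_(~` [set 0]) \o (fun y => rad (c y) (w y))).
    apply: measurableT_comp; last exact: measurable_rad.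
    by apply: measurable_indic; exact: measurableC.
  apply/funext => y /=; rewrite indicE; congr (nat_of_bool _)%:R.
  by apply/esym; apply/idP/idP; rewrite inE /= => /eqP.
apply: measurable_funM.
  apply: measurable_six_wave; apply: jointly_measurable_comp => //.
  exact: measurable_v5.
apply: measurable_fun_ge0_inv => [|y]; last exact: sqrtr_ge0.
exact: measurableT_comp (@measurable_ellgrad R) mu.
Qed.

Lemma C6E f (t x v : R) : jointly_measurable f -> C6 f t x v =
  \int[(lebesgue_measure \x lebesgue_measure)%E]_w
    \int[ellm]_(u in ellipse) collision f t x v w u.
Proof.
move=> mf; apply: eq_Rintegral => w _; apply: delta_integral_Omega.
apply: measurable_six_wave; apply: jointly_measurable_comp => //.
exact: measurable_v5.
Qed.

Lemma jointly_measurable_C6 f : jointly_measurable f -> jointly_measurable (C6 f).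
Proof.
move=> mf; rewrite /jointly_measurable.
rewrite (_ : (fun _ => _) = fun p : R * R * R =>
  \int[(lebesgue_measure \x lebesgue_measure)%E]_w
    \int[ellm]_(u in ellipse) collision f p.1.1 p.1.2 p.2 w u); last first.
  by apply/funext => p; rewrite C6E.
apply: measurable_fun_Rintegral_prod.
pose F (q : (R * R * R) * (R * R)) u := collision f q.1.1.1 q.1.1.2 q.1.2 q.2 u.
rewrite [X in measurable_fun _ X](_ : _ = fun z => \int[ellm]_(u in ellipse) F z u)//.
apply: measurable_fun_Rintegral; first exact: measurable_ellipse.
rewrite /F; apply: measurable_collision => //.
- by apply: measurableT_comp => //; apply: measurableT_comp => //; exact: measurableT_comp.
- by apply: measurableT_comp => //; apply: measurableT_comp => //; exact: measurableT_comp.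
- by apply: measurableT_comp => //; exact: measurableT_comp.
- exact: measurableT_comp.
Qed.

End collision_measurable.

(** * The collision estimate *)

Section close.
Context {R : realDomainType}.
Implicit Types (a b B E : R).

(** Sizes and difference are bundled because the product rule for a difference consumes all three
    bounds. Taking [b = 0] and [E = B] recovers a plain bound on the size of [a]. *)
Definition close B E a b := [/\ `|a| <= B, `|b| <= B & `|a - b| <= E].

Lemma closeM B E B' E' a b a' b' : close B E a b -> close B' E' a' b' ->
  close (B * B') (E * B' + B * E') (a * a') (b * b').
Proof.
move=> [aB bB abE] [aB' bB' abE']; split; rewrite ?normrM ?ler_pM//.
rewrite (_ : _ - _ = (a - b) * a' + b * (a' - b')); last by ring.
apply: le_trans (ler_normD _ _) _; rewrite !normrM.
by apply: lerD; exact: ler_pM.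
Qed.

Lemma closeD B E B' E' a b a' b' : close B E a b -> close B' E' a' b' ->
  close (B + B') (E + E') (a + a') (b + b').
Proof.
move=> [aB bB abE] [aB' bB' abE']; split.
- by apply: le_trans (ler_normD _ _) _; exact: lerD.
- by apply: le_trans (ler_normD _ _) _; exact: lerD.
- by rewrite opprD addrACA; apply: le_trans (ler_normD _ _) _; exact: lerD.
Qed.

Lemma closeN B E a b : close B E a b -> close B E (- a) (- b).
Proof. by move=> [? ? ?]; split; rewrite -?opprD normrN. Qed.

Lemma close_le B E B' E' a b : B <= B' -> E <= E' -> close B E a b ->
  close B' E' a b.
Proof.
move=> BB EE [? ? ?].
by split; [exact: le_trans BB|exact: le_trans BB|exact: le_trans EE].
Qed.

(** By the Leibniz rule each of the five factors supplies the difference once, which gives the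
    coefficient [5 * M ^+ 4 * D]. *)
Lemma close_prod5 (M D P a0 a1 a2 a3 a4 b0 b1 b2 b3 b4 w0 w1 w2 w3 w4 : R) :
  0 <= M -> 0 <= D -> w0 * w1 * w2 * w3 * w4 <= P ->
  close (M * w0) (D * w0) a0 b0 -> close (M * w1) (D * w1) a1 b1 ->
  close (M * w2) (D * w2) a2 b2 -> close (M * w3) (D * w3) a3 b3 ->
  close (M * w4) (D * w4) a4 b4 ->
  close (M ^+ 5 * P) (5 * M ^+ 4 * D * P)
    (a0 * a1 * a2 * a3 * a4) (b0 * b1 * b2 * b3 * b4).
Proof.
move=> M0 D0 wP c0 c1 c2 c3 c4.
have := closeM (closeM (closeM (closeM c0 c1) c2) c3) c4.
apply: close_le.
  rewrite (_ : _ * _ = M ^+ 5 * (w0 * w1 * w2 * w3 * w4)); last by ring.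
  by rewrite ler_wpM2l// exprn_ge0.
rewrite [leLHS](_ : _ = (5 * M ^+ 4 * D) * (w0 * w1 * w2 * w3 * w4)); last by ring.
by rewrite ler_wpM2l// !mulr_ge0// exprn_ge0.
Qed.

End close.

Section six_wave_estimate.
Context {R : realType}.

(** Each monomial contains all of indices 0, 1, 2 or all of 3, 4, 5, and either triple contributes
    the weight [w0 * w1 * w2]. The weights of its two other factors are at most 1 and are discarded.
    Six monomials with five differences each give the constant 30. *)
Lemma close_six_wave (M D a0 a1 a2 a3 a4 a5 b0 b1 b2 b3 b4 b5
    w0 w1 w2 w3 w4 w5 : R) : 0 <= M -> 0 <= D ->
  0 <= w0 <= 1 -> 0 <= w1 <= 1 -> 0 <= w2 <= 1 ->
  0 <= w3 <= 1 -> 0 <= w4 <= 1 -> 0 <= w5 <= 1 ->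
  w3 * w4 * w5 = w0 * w1 * w2 ->
  close (M * w0) (D * w0) a0 b0 -> close (M * w1) (D * w1) a1 b1 ->
  close (M * w2) (D * w2) a2 b2 -> close (M * w3) (D * w3) a3 b3 ->
  close (M * w4) (D * w4) a4 b4 -> close (M * w5) (D * w5) a5 b5 ->
  close (6 * M ^+ 5 * (w0 * w1 * w2)) (30 * M ^+ 4 * D * (w0 * w1 * w2))
    (six_wave a0 a1 a2 a3 a4 a5) (six_wave b0 b1 b2 b3 b4 b5).
Proof.
move=> M0 D0 i0 i1 i2 i3 i4 i5 w345 c0 c1 c2 c3 c4 c5.
pose P := w0 * w1 * w2.
have le2 x y : 0 <= x <= 1 -> 0 <= y <= 1 -> P * x * y <= P.
  move=> /andP[x0 x1] /andP[y0 y1]; rewrite -mulrA ler_piMr ?mulr_ile1//.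
  by case/andP: i0 => ? _; case/andP: i1 => ? _; case/andP: i2 => ? _; rewrite !mulr_ge0.
have out x y a a' b b' (ix : 0 <= x <= 1) (iy : 0 <= y <= 1)
    (c : close (M * x) (D * x) a b) (c' : close (M * y) (D * y) a' b') :=
  close_prod5 M0 D0 (le2 x y ix iy) c0 c1 c2 c c'.
have gain x y a a' b b' (ix : 0 <= x <= 1) (iy : 0 <= y <= 1)
    (c : close (M * x) (D * x) a b) (c' : close (M * y) (D * y) a' b') :
    close (M ^+ 5 * P) (5 * M ^+ 4 * D * P) (a3 * a4 * a5 * a * a')
      (b3 * b4 * b5 * b * b').
  by apply: (close_prod5 M0 D0 _ c3 c4 c5 c c'); rewrite w345; exact: le2.
have := closeD (closeD (closeD (gain _ _ _ _ _ _ i0 i1 c0 c1)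
  (gain _ _ _ _ _ _ i0 i2 c0 c2)) (gain _ _ _ _ _ _ i1 i2 c1 c2))
  (closeN (closeD (closeD (out _ _ _ _ _ _ i3 i4 c3 c4)
  (out _ _ _ _ _ _ i3 i5 c3 c5)) (out _ _ _ _ _ _ i4 i5 c4 c5))).
have E (x0 x1 x2 x3 x4 x5 : R) : six_wave x0 x1 x2 x3 x4 x5 =
  (x3 * x4 * x5 * x0 * x1 + x3 * x4 * x5 * x0 * x2 + x3 * x4 * x5 * x1 * x2) -
  (x0 * x1 * x2 * x3 * x4 + x0 * x1 * x2 * x3 * x5 + x0 * x1 * x2 * x4 * x5).
  by rewrite /six_wave; ring.
rewrite !E.
by apply: close_le; rewrite le_eqVlt; apply/orP; left; apply/eqP; rewrite /P; ring.
Qed.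

End six_wave_estimate.

Section integral_estimates.
Context d (T : measurableType d) {R : realType} (mu : {measure set T -> \bar R}).

Lemma integrable_le_norm (D : set T) (f b : T -> R) : measurable D ->
  measurable_fun D f -> mu.-integrable D (EFin \o b) ->
  (forall x, D x -> `|f x| <= b x) -> mu.-integrable D (EFin \o f).
Proof.
move=> mD mf ib fb; apply: le_integrable ib => //; first exact/measurable_EFinP.
by move=> x Dx /=; rewrite lee_fin (le_trans (fb x Dx))// ler_norm.
Qed.

Lemma norm_Rintegral_le (D : set T) (f b : T -> R) : measurable D ->
  measurable_fun D f -> mu.-integrable D (EFin \o b) ->
  (forall x, D x -> `|f x| <= b x) ->
  `|\int[mu]_(x in D) f x| <= \int[mu]_(x in D) b x.
Proof.
move=> mD mf ib fb; have fi := integrable_le_norm mD mf ib fb.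
apply: le_trans (le_normr_Rintegral mD fi) _.
by apply: le_Rintegral => //; exact: integrable_norm.
Qed.

Lemma close_Rintegral (D : set T) (f g b c : T -> R) : measurable D ->
  measurable_fun D f -> measurable_fun D g ->
  mu.-integrable D (EFin \o b) -> mu.-integrable D (EFin \o c) ->
  (forall x, D x -> close (b x) (c x) (f x) (g x)) ->
  close (\int[mu]_(x in D) b x) (\int[mu]_(x in D) c x)
    (\int[mu]_(x in D) f x) (\int[mu]_(x in D) g x).
Proof.
move=> mD mf mg ib ic fg.
have fb x : D x -> `|f x| <= b x by move=> /fg[].
have gb x : D x -> `|g x| <= b x by move=> /fg[].
split; try exact: norm_Rintegral_le.
rewrite -RintegralB//; try exact: integrable_le_norm ib _.
apply: norm_Rintegral_le => //; first exact: measurable_funB.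
by move=> x /fg[].
Qed.

End integral_estimates.

(** * Gaussian velocity integrals *)

Section gaussian.
Context {R : realType}.
Notation leb := (@lebesgue_measure R).

Lemma integral_expR_sqr (g m : R) : 0 < g ->
  (\int[leb]_z (expR (- (g * (z - m) ^+ 2)))%:E = (Num.sqrt (pi / g))%:E)%E.
Proof.
(* The standard deviation for which the normal density is proportional to the given Gaussian. *)
move=> g0; pose s : R := (Num.sqrt (2 * g))^-1.
have g20 : 0 < 2 * g by rewrite mulr_gt0.
have s2 : s ^+ 2 = (2 * g)^-1 by rewrite exprVn sqr_sqrtr// ltW.
have s0 : s != 0 by rewrite invr_eq0 gt_eqF// sqrtr_gt0.
have pg : 0 < Num.sqrt (pi / g) by rewrite sqrtr_gt0 divr_gt0// pi_gt0.
have E z : expR (- (g * (z - m) ^+ 2)) = Num.sqrt (pi / g) * normal_pdf m s z.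
  rewrite normal_pdfE// /normal_peak /normal_fun s2.
  rewrite (_ : (2 * g)^-1 * pi *+ 2 = pi / g); last by field; rewrite gt_eqF.
  rewrite /= mulVKf ?gt_eqF//; congr expR.
  by field; rewrite gt_eqF.
under eq_integral do rewrite E EFinM.
rewrite ge0_integralZl//=.
- by rewrite integral_normal_pdf// mule1.
- by apply: measurableT_comp => //; exact: measurable_normal_pdf.
- by move=> z _; rewrite lee_fin normal_pdf_ge0.
Qed.

Lemma integral_prod_square (g : R -> R) (G : R) : measurable_fun setT g ->
  (forall z, 0 <= g z) -> (\int[leb]_z (g z)%:E = G%:E)%E ->
  (\int[(leb \x leb)%E]_w (g w.1 * g w.2)%:E = (G ^+ 2)%:E)%E.
Proof.
move=> mg g0 gG.
have G0 : 0 <= G by rewrite -lee_fin -gG integral_ge0// => z _; rewrite lee_fin.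
have m2 : measurable_fun setT (fun w : R * R => (g w.1 * g w.2)%:E).
  by apply/measurable_EFinP; apply: measurable_funM; exact: measurableT_comp.
have mEg : measurable_fun setT (EFin \o g) by exact/measurable_EFinP.
rewrite fubini_tonelli1//; last by move=> w; rewrite lee_fin mulr_ge0.
rewrite /fubini_F /=.
under eq_integral => x _.
  under eq_integral do rewrite EFinM.
  rewrite ge0_integralZl//; last 2 first.
  - by move=> z _; rewrite lee_fin.
  - by rewrite lee_fin.
  rewrite gG muleC.
  over.
rewrite ge0_integralZl//; last by move=> z _; rewrite lee_fin.
by rewrite gG expr2 EFinM.
Qed.

(** The Gaussian weight at [(y - t * z, z)], where [y - t * z] is the time-zero position of a free
    particle found at [y] at time [t]. Collisions act at fixed [t] and [y], so only the dependence
    on [z] is integrated. *)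
Definition gweight (a b t y z : R) : R :=
  expR (- (a * (y - t * z) ^+ 2 + b * z ^+ 2)).

Lemma measurable_gweight a b t y : measurable_fun setT (gweight a b t y).
Proof.
apply: measurableT_comp => //; apply: measurableT_comp => //.
apply: measurable_funD; apply: measurable_funM => //; apply: measurable_funX => //.
by apply: measurable_funB => //; exact: measurable_funM.
Qed.

Lemma gweight01 a b t y z : 0 < a -> 0 < b -> 0 <= gweight a b t y z <= 1.
Proof.
move=> a0 b0; rewrite expR_ge0/= -[leRHS]expR0 ler_expR oppr_le0.
by rewrite addr_ge0// mulr_ge0 ?sqr_ge0// ltW.
Qed.

(** Completing the square in [z] leaves the factor [exp(- (a * b / g) * y^2)], which is dropped to
    make the bound uniform in the position. *)
Lemma integral_gweight_le a b t y : 0 < a -> 0 < b ->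
  (\int[leb]_z (gweight a b t y z)%:E <= (Num.sqrt (pi / (a * t ^+ 2 + b)))%:E)%E.
Proof.
move=> a0 b0; pose g := a * t ^+ 2 + b.
have g0 : 0 < g by rewrite ltr_wpDl// mulr_ge0 ?sqr_ge0// ltW.
have m1 : measurable_fun setT (EFin \o gweight a b t y).
  by apply/measurable_EFinP; exact: measurable_gweight.
have m2 : measurable_fun setT
    (EFin \o fun z : R => expR (- (g * (z - a * t * y / g) ^+ 2))).
  apply/measurable_EFinP; apply: measurableT_comp => //; apply: measurableT_comp => //.
  apply: measurable_funM => //; apply: measurable_funX => //.
  exact: measurable_funB.
rewrite -(integral_expR_sqr (a * t * y / g) g0).
apply: ge0_le_integral => //; first by move=> z _; rewrite lee_fin expR_ge0.
move=> z _; rewrite lee_fin ler_expR lerN2.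
have -> : a * (y - t * z) ^+ 2 + b * z ^+ 2 =
    g * (z - a * t * y / g) ^+ 2 + a * b / g * y ^+ 2.
  by rewrite /g; field; rewrite gt_eqF.
by rewrite lerDl mulr_ge0 ?sqr_ge0// divr_ge0 ?mulr_ge0// ltW.
Qed.

(** The square of the bound for a single velocity integral, since [v1] and [v2] both remain to be
    integrated. One integral alone would decay like [1 / |t|], which is not integrable; two give
    [1 / t^2]. *)
Definition decay (a b t : R) : R := pi / (a * t ^+ 2 + b).

Lemma integrable_gweight2 a b t y : 0 < a -> 0 < b ->
  (leb \x leb)%E.-integrable setT
    (EFin \o fun w : R * R => gweight a b t y w.1 * gweight a b t y w.2) /\
  \int[(leb \x leb)%E]_w (gweight a b t y w.1 * gweight a b t y w.2) <= decay a b t.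
Proof.
move=> a0 b0; have mg := measurable_gweight a b t y.
have d0 : 0 < a * t ^+ 2 + b by rewrite ltr_wpDl// mulr_ge0 ?sqr_ge0// ltW.
set G := (\int[leb]_z (gweight a b t y z)%:E)%E.
have Gle : (G <= (Num.sqrt (decay a b t))%:E)%E by exact: integral_gweight_le.
have Gge0 : (0 <= G)%E by apply: integral_ge0 => z _; rewrite lee_fin expR_ge0.
have GE : G = (fine G)%:E.
  by rewrite fineK// ge0_fin_numE//; exact: le_lt_trans Gle (ltry _).
have /= I := integral_prod_square mg (fun z => expR_ge0 _) GE.
split.
  apply/integrableP; split.
    by apply/measurable_EFinP; apply: measurable_funM; exact: measurableT_comp.
  under eq_integral do rewrite /= ger0_norm ?mulr_ge0 ?expR_ge0//.
  by rewrite I ltry.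
rewrite /Rintegral I /= -[leRHS]sqr_sqrtr; last by rewrite divr_ge0 ?pi_ge0// ltW.
rewrite ler_sqr ?nnegrE ?fine_ge0 ?sqrtr_ge0//.
by rewrite -lee_fin -GE.
Qed.

End gaussian.

Section collision_estimate.
Context {R : realType}.
Notation leb := (@lebesgue_measure R).
Implicit Types (f g : R -> R -> R -> R) (w u : R * R).

(** The exponent [a * (y - t * z)^2 + b * z^2] is a quadratic polynomial in [z]. Its sums over the
    two triples agree because energy, momentum and the number of particles are the same on both
    sides. *)
Lemma gweight_conserved (a b t y v : R) w u : ellipse u ->
  gweight a b t y (onell v w u).1 * gweight a b t y (onell v w u).2 *
    gweight a b t y (v5 v w.1 w.2 (onell v w u).1 (onell v w u).2) =
  gweight a b t y v * gweight a b t y w.1 * gweight a b t y w.2.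
Proof.
move=> u1; have : Omega v w.1 w.2 (onell v w u).1 (onell v w u).2 = 0.
  rewrite Omega_ellq /onell /affine2/= -[X in X - _]mulr1 -{1}u1 /ellq/=; ring.
rewrite /Omega; set z3 := (onell v w u).1; set z4 := (onell v w u).2.
set z5 := v5 v w.1 w.2 z3 z4 => E.
have S : v + w.1 + w.2 - z3 - z4 - z5 = 0 by rewrite /z5 /v5; ring.
rewrite -!expRD; congr expR; apply/eqP; rewrite -subr_eq0; apply/eqP.
rewrite [LHS](_ : _ =
  (a * t ^+ 2 + b) * (v ^+ 2 + w.1 ^+ 2 + w.2 ^+ 2 - z3 ^+ 2 - z4 ^+ 2 - z5 ^+ 2)
  - 2 * a * y * t * (v + w.1 + w.2 - z3 - z4 - z5)); last by ring.
by rewrite E S !mulr0 subrr.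
Qed.

Definition ellmass : R := fine (hausdorff1 (@ellipse R)).

Lemma ellmass_ge0 : 0 <= ellmass.
Proof. by rewrite fine_ge0// hausdorff1_ge0. Qed.

Lemma Rintegral_ellm_cst (r : R) : \int[ellm]_(u in ellipse) r = r * ellmass.
Proof.
rewrite Rintegral_cst; last exact: measurable_ellipse.
by rewrite /ellm/= /mfrestr /mrestr setIid.
Qed.

(** The constants 3 and 15 are half of the 6 and 30 for [six_wave], since [ellgrad] is at least 2 on
    the ellipse. *)
Lemma close_collision a b f g t y v w u (M D : R) : 0 < a -> 0 < b ->
  0 <= M -> 0 <= D -> ellipse u ->
  (forall z, close (M * gweight a b t y z) (D * gweight a b t y z)
    (f t y z) (g t y z)) ->
  close (3 * M ^+ 5 * gweight a b t y v *
      (gweight a b t y w.1 * gweight a b t y w.2))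
    (15 * M ^+ 4 * D * gweight a b t y v *
      (gweight a b t y w.1 * gweight a b t y w.2))
    (collision f t y v w u) (collision g t y v w u).
Proof.
move=> a0 b0 M0 D0 u1 fg.
have w01 z := gweight01 t y z a0 b0.
have c6 := close_six_wave M0 D0 (w01 _) (w01 _) (w01 _) (w01 _) (w01 _) (w01 _)
  (gweight_conserved a b t y v w u1) (fg _) (fg _) (fg _) (fg _) (fg _) (fg _).
have g2 := ellgrad_ge2 u1.
have ci : close (2^-1) 0 ((ellgrad u)^-1) ((ellgrad u)^-1).
  have : `|(ellgrad u)^-1| <= 2^-1.
    rewrite ger0_norm ?invr_ge0; last by apply: le_trans g2.
    by rewrite lef_pV2 ?posrE//; exact: (lt_le_trans _ g2).
  by move=> gi; split => //; rewrite subrr normr0.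
have cr : close (1 : R) 0 (rad v w != 0)%:R (rad v w != 0)%:R.
  have : `|(rad v w != 0)%:R| <= 1 :> R by rewrite normr_nat; case: (_ != _).
  by move=> ri; split => //; rewrite subrr normr0.
apply: close_le (closeM cr (closeM c6 ci)).
  by rewrite le_eqVlt; apply/orP; left; apply/eqP; field.
by rewrite le_eqVlt; apply/orP; left; apply/eqP; field.
Qed.

Lemma norm_C6B_le a b f g t y v (M D : R) : 0 < a -> 0 < b ->
  0 <= M -> 0 <= D -> jointly_measurable f -> jointly_measurable g ->
  (forall z, close (M * gweight a b t y z) (D * gweight a b t y z)
    (f t y z) (g t y z)) ->
  `|C6 f t y v - C6 g t y v| <=
  15 * ellmass * M ^+ 4 * D * decay a b t * gweight a b t y v.
Proof.
move=> a0 b0 M0 D0 mf mg fg; rewrite !C6E//.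
have [ig gd] := integrable_gweight2 t y a0 b0.
have mE := @measurable_ellipse R.
have mc h w : jointly_measurable h ->
    measurable_fun setT (fun u => collision h t y v w u).
  by move=> mh; exact: measurable_collision.
pose B w := gweight a b t y w.1 * gweight a b t y w.2.
have cE w : close
    (3 * M ^+ 5 * gweight a b t y v * ellmass * B w)
    (15 * M ^+ 4 * D * gweight a b t y v * ellmass * B w)
    (\int[ellm]_(u in ellipse) collision f t y v w u)
    (\int[ellm]_(u in ellipse) collision g t y v w u).
  rewrite -![_ * ellmass * _]mulrAC -!Rintegral_ellm_cst.
  apply: close_Rintegral => //.
  - by apply: measurable_funTS; exact: mc.
  - by apply: measurable_funTS; exact: mc.
  - exact: finite_measure_integrable_cst.
  - exact: finite_measure_integrable_cst.
  by move=> u u1; exact: close_collision.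
have mI h : jointly_measurable h -> measurable_fun setT
    (fun w => \int[ellm]_(u in ellipse) collision h t y v w u).
  by move=> mh; apply: measurable_fun_Rintegral => //; exact: measurable_collision.
have iZ (k : R) : (leb \x leb)%E.-integrable setT (EFin \o fun w => k * B w).
  rewrite (_ : _ \o _ = fun w => (k%:E * (EFin \o B) w)%E); first exact: integrableZl.
  by apply/funext => w; rewrite /= EFinM.
have [_ _] := @close_Rintegral _ _ R (leb \x leb)%E setT _ _ _ _
  measurableT (mI f mf) (mI g mg) (iZ _) (iZ _)
  (fun w _ => cE w).
move=> /le_trans; apply; rewrite RintegralZl//.
rewrite [leRHS](_ : _ = 15 * M ^+ 4 * D * gweight a b t y v * ellmass * decay a b t);
  last by ring.
apply: ler_wpM2l => //.
by rewrite !mulr_ge0 ?ellmass_ge0 ?exprn_ge0// expR_ge0.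
Qed.

End collision_estimate.

(** * Time decay *)

Section decay.
Context {R : realType} (a b : R).
Hypotheses (a0 : 0 < a) (b0 : 0 < b).
Notation leb := (@lebesgue_measure R).

Definition decay_prim (t : R) : R :=
  pi / Num.sqrt (a * b) * atan (Num.sqrt (a / b) * t).

(** The limit at [+oo] of the odd primitive [decay_prim]; the integral of [decay] over all times is
    therefore twice this number. *)
Definition decay_mass : R := pi / Num.sqrt (a * b) * (pi / 2).

Let den_gt0 (t : R) : 0 < a * t ^+ 2 + b.
Proof. by rewrite ltr_wpDl// mulr_ge0 ?sqr_ge0// ltW. Qed.

Lemma decay_ge0 t : 0 <= decay a b t.
Proof. by rewrite divr_ge0 ?pi_ge0// ltW. Qed.

Lemma decayN t : decay a b (- t) = decay a b t.
Proof. by rewrite /decay sqrrN. Qed.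

Lemma decay_primN t : decay_prim (- t) = - decay_prim t.
Proof. by rewrite /decay_prim mulrN atanN mulrN. Qed.

Lemma continuous_decay : continuous (decay a b).
Proof.
move=> t; apply: cvgM; first exact: cvg_cst.
apply: cvgV; first by rewrite gt_eqF.
apply: cvgD; last exact: cvg_cst.
by apply: cvgM; [exact: cvg_cst|exact: sqr_continuous].
Qed.

Lemma is_derive_decay_prim t : is_derive (t : R) (1 : R) decay_prim (decay a b t).
Proof.
have p0 : 0 < Num.sqrt (a * b) by rewrite sqrtr_gt0 mulr_gt0.
have p2 : Num.sqrt (a * b) ^+ 2 = a * b by rewrite sqr_sqrtr// mulr_ge0// ltW.
have q : Num.sqrt (a / b) = Num.sqrt (a * b) / b.
  rewrite (_ : a / b = (a * b) * (b^-1) ^+ 2); last by field; rewrite gt_eqF.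
  rewrite sqrtrM; last by rewrite mulr_ge0// ltW.
  by rewrite sqrtr_sqr ger0_norm// invr_ge0 ltW.
rewrite /decay_prim; apply: is_derive_eq; rewrite /GRing.scale/= mulr1 q.
rewrite (_ : 1 + (_ * t) ^+ 2 = (a * t ^+ 2 + b) / b).
  by rewrite /decay; field; rewrite !gt_eqF//= mulr_gt0.
by rewrite !exprMn p2; field; rewrite gt_eqF.
Qed.

Lemma decay_prim_bound t : - decay_mass <= decay_prim t <= decay_mass.
Proof.
have c0 : 0 <= pi / Num.sqrt (a * b) by rewrite divr_ge0 ?pi_ge0 ?sqrtr_ge0.
by rewrite -mulrN !ler_wpM2l// ltW ?atan_ltpi2// atan_gtNpi2.
Qed.

Lemma cvgy_decay_prim : decay_prim t @[t --> +oo] --> decay_mass.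
Proof.
apply: cvgM; first exact: cvg_cst.
have q0 : 0 < Num.sqrt (a / b) by rewrite sqrtr_gt0 divr_gt0.
apply: (@cvg_comp _ _ _ (fun t => Num.sqrt (a / b) * t) atan _ +oo).
  exact: gt0_cvgMry cvg_id.
exact: cvgy_atan.
Qed.

Lemma cvgNy_decay_prim : decay_prim t @[t --> -oo] --> - decay_mass.
Proof.
apply/cvgNy_compNP; rewrite [X in X @ _](_ : _ = fun t => - decay_prim t).
  by apply: cvgN; exact: cvgy_decay_prim.
by apply/funext => t /=; rewrite decay_primN.
Qed.

Let derivable_prim t : derivable decay_prim (t : R) 1.
Proof. by case: (is_derive_decay_prim t). Qed.

Let derive1_prim t : derive1 decay_prim t = decay a b t.
Proof. by rewrite derive1E; have := is_derive_decay_prim t => ?; rewrite derive_val. Qed.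

Let continuous_prim : continuous decay_prim.
Proof. by move=> t; apply/differentiable_continuous/derivable1_diffP. Qed.

Lemma integral_itvcy_decay t :
  (\int[leb]_(s in `[t, +oo[) (decay a b s)%:E = (decay_mass - decay_prim t)%:E)%E.
Proof.
rewrite (@ge0_continuous_FTC2y _ _ decay_prim _ decay_mass)//.
- by move=> x _; exact: decay_ge0.
- by apply: continuous_subspaceT => x; exact: continuous_decay.
- exact: cvgy_decay_prim.
- by apply: cvg_at_right_filter; exact: continuous_prim.
Qed.

Lemma integral_itvNyc_decay t :
  (\int[leb]_(s in `]-oo, t]) (decay a b s)%:E = (decay_mass + decay_prim t)%:E)%E.
Proof.
rewrite -[t]opprK ge0_integration_by_substitutionNy.
- under eq_integral do rewrite /= decayN.
  by rewrite integral_itvcy_decay !decay_primN.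
- by apply: continuous_subspaceT => x; exact: continuous_decay.
- by move=> x _; exact: decay_ge0.
Qed.

Lemma measurable_decay : measurable_fun setT (decay a b).
Proof. exact: continuous_measurable_fun continuous_decay. Qed.

Lemma integrable_decay : leb.-integrable setT (EFin \o decay a b).
Proof.
have mE : measurable_fun setT (EFin \o decay a b).
  by apply/measurable_EFinP; exact: measurable_decay.
apply/integrableP; split => //.
under eq_integral do rewrite /= ger0_norm ?decay_ge0//.
have -> : [set: R] = `]-oo, 0] `|` `]0, +oo[.
  apply/seteqP; split => // x _ /=; rewrite !in_itv/= andbT.
  by have [?|?] := leP x 0; [left|right].
rewrite ge0_integral_setU//=.
- rewrite integral_itvNyc_decay lte_add_pinfty ?ltry//.
  apply: (@le_lt_trans _ _ (\int[leb]_(s in `[0%R, +oo[) (decay a b s)%:E)%E).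
    apply: ge0_subset_integral => //.
    - exact: measurable_funTS.
    - by move=> x _; rewrite lee_fin decay_ge0.
    - by apply: subset_itvr; rewrite bnd_simp.
  by rewrite integral_itvcy_decay ltry.
- exact: measurable_funTS.
- by move=> x _; rewrite lee_fin decay_ge0.
- rewrite disj_set2E; apply/eqP/seteqP; split => // x [] /=; rewrite !in_itv/= andbT.
  by move=> x0; rewrite ltNge x0.
Qed.

Lemma integral_decay_expR (l s t : R) : 0 < l -> s <= t ->
  \int[leb]_(r in `[s, t]) (decay a b r * expR (l * decay_prim r)) =
  (expR (l * decay_prim t) - expR (l * decay_prim s)) / l.
Proof.
move=> l0; rewrite le_eqVlt => /predU1P[->|st].
  by rewrite set_itv1 Rintegral_set1 subrr mul0r.
pose G (r : R) := expR (l * decay_prim r) / l.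
have dG (r : R) : is_derive r (1 : R) G (decay a b r * expR (l * decay_prim r)).
  have dp := is_derive_decay_prim r.
  apply: is_derive_eq; rewrite /GRing.scale/=; field; rewrite gt_eqF//.
have cG : continuous G.
  move=> r; apply/differentiable_continuous/derivable1_diffP.
  by case: (dG r).
rewrite /Rintegral (@continuous_FTC2 _ _ G)//.
- by rewrite -EFinB /= /G mulrBl.
- apply: continuous_subspaceT => r; apply: cvgM; first exact: continuous_decay.
  apply: (@cvg_comp _ _ _ (fun r => l * decay_prim r) expR); last exact: continuous_expR.
  by apply: cvgM; [exact: cvg_cst|exact: continuous_prim].
- split.
  + by move=> r _; case: (dG r).
  + by apply: cvg_at_right_filter; exact: cG.
  + by apply: cvg_at_left_filter; exact: cG.
- by move=> r _; rewrite derive1E; have := dG r => ?; rewrite derive_val.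
Qed.

End decay.

(** * Small-data scattering in the interaction picture *)

Section geometric.
Context {R : realType}.

Lemma expr2_gt (c : R) : exists n : nat, c < 2 ^+ n.
Proof.
have [c0|c0] := leP 0 c; last by exists 0%N; rewrite expr0; exact: lt_trans c0 _.
exists (Num.trunc c).+1; have /andP[_ h] := truncn_itv c0.
by apply: lt_trans h _; rewrite -natrX ltr_nat ltn_expl.
Qed.

Lemma eq0_le_geometric (c x : R) : (forall n, `|x| <= c / 2 ^+ n) -> x = 0.
Proof.
move=> xc; apply/eqP; rewrite -normr_eq0 eq_le normr_ge0 andbT leNgt.
apply/negP => x0; have [n] := expr2_gt (c / `|x|).
rewrite ltr_pdivrMr// mulrC -ltr_pdivrMr ?exprn_gt0//.
by rewrite ltNge xc.
Qed.

Lemma cvg_geometric_cauchy (u : nat -> R) (c : R) :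
  (forall n m, `|u (n + m)%N - u n| <= c / 2 ^+ n) ->
  cvgn u /\ (forall n, `|limn u - u n| <= c / 2 ^+ n).
Proof.
move=> uc.
have cu : cvgn u.
  apply/cauchy_cvgP/cauchy_exP => e e0; have [n] := expr2_gt (c / e).
  rewrite ltr_pdivrMr// mulrC -ltr_pdivrMr ?exprn_gt0// => ne.
  exists (u n), n => // m /= nm; rewrite -ball_normE /= distrC.
  by rewrite -(subnKC nm); exact: le_lt_trans (uc _ _) ne.
split=> // n; apply/ler_addgt0Pr => e e0.
have /cvgrPdist_lt /(_ _ e0) [m _ um] := cu.
have {}um := um (n + m)%N (leq_addl _ _).
rewrite (_ : _ - _ = (limn u - u (n + m)%N) + (u (n + m)%N - u n)); last by ring.
apply: le_trans (ler_normD _ _) _; rewrite addrC; apply: lerD; first exact: uc.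
exact: ltW.
Qed.

End geometric.

(* Interaction picture: the unknown is [F t = T^{-t} f(t)] and the equation reads
   [F' = N F].  [tame a b C w N] records all that is used of [N]: it is quintic,
   local in time, preserves the weight [w], and decays in time like [decay a b]. *)
Definition tame {R : realType} (a b C : R) (w : R -> R -> R)
    (N : (R -> R -> R -> R) -> R -> R -> R -> R) : Prop :=
  [/\ (forall F, jointly_measurable F -> jointly_measurable (N F)),
      (forall F G (M D t : R), 0 <= M -> 0 <= D ->
        jointly_measurable F -> jointly_measurable G ->
        (forall x v, close (M * w x v) (D * w x v) (F t x v) (G t x v)) ->
        forall x v,
          `|N F t x v - N G t x v| <= C * M ^+ 4 * D * w x v * decay a b t) &
      (forall t x v, N (fun _ _ _ => 0) t x v = 0)].

Definition bounded_by {R : realType} (w : R -> R -> R) (F : R -> R -> R -> R)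
  (M : R) := forall t x v, `|F t x v| <= M * w x v.

Definition duhamel {R : realType} (N : (R -> R -> R -> R) -> R -> R -> R -> R)
  (F : R -> R -> R -> R) := forall t x v,
  F t x v = F 0 x v + oriented_integral 0 t (fun s => N F s x v).

Section duhamel.
Context {R : realType} (a b C : R) (w : R -> R -> R)
  (N : (R -> R -> R -> R) -> R -> R -> R -> R).
Notation leb := (@lebesgue_measure R).
Notation k := (decay a b).
Notation K := (decay_prim a b).
Notation mass := (decay_mass a b).
Implicit Types F G : R -> R -> R -> R.

Hypotheses (a0 : 0 < a) (b0 : 0 < b) (C0 : 0 <= C).
Hypothesis w0 : forall x v, 0 <= w x v.
Hypothesis tameN : tame a b C w N.

Notation bounded_by := (bounded_by w).
Notation duhamel := (duhamel N).

Let N_measurable F : jointly_measurable F -> jointly_measurable (N F).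
Proof. by case: tameN => h _ _; exact: h. Qed.

Let N_lipschitz F G (M D t : R) : 0 <= M -> 0 <= D ->
  jointly_measurable F -> jointly_measurable G ->
  (forall x v, close (M * w x v) (D * w x v) (F t x v) (G t x v)) ->
  forall x v, `|N F t x v - N G t x v| <= C * M ^+ 4 * D * w x v * k t.
Proof. by case: tameN => _ h _; exact: h. Qed.

Let N0 t x v : N (fun _ _ _ => 0) t x v = 0.
Proof. by case: tameN. Qed.

Definition past F t x v : R := \int[leb]_(s in `]-oo, t]) N F s x v.

Definition total F x v : R := \int[leb]_s N F s x v.

Lemma jointly_measurable0 : jointly_measurable (fun _ _ _ => 0 : R).
Proof. exact: measurable_cst. Qed.

Lemma measurable_time_slice F x v : jointly_measurable F ->
  measurable_fun setT (fun s => F s x v).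
Proof. by move=> mF; apply: jointly_measurable_comp. Qed.

Lemma measurable_N_slice F x v : jointly_measurable F ->
  measurable_fun setT (fun s => N F s x v).
Proof. by move=> mF; exact: measurable_time_slice (N_measurable mF). Qed.

(** This is the Lipschitz estimate against the zero function, with [D = M]. *)
Lemma norm_N_le F M t x v : 0 <= M -> jointly_measurable F -> bounded_by F M ->
  `|N F t x v| <= C * M ^+ 5 * w x v * k t.
Proof.
move=> M0 mF FM; have := @N_lipschitz F _ M M t M0 M0 mF jointly_measurable0.
have cF x' v' : close (M * w x' v') (M * w x' v') (F t x' v') 0.
  by split; rewrite ?subr0 ?normr0 ?mulr_ge0//; exact: FM.
move=> /(_ cF x v); rewrite N0 subr0 => /le_trans; apply.
by rewrite le_eqVlt; apply/orP; left; apply/eqP; ring.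
Qed.

Lemma integrable_decayZ (c : R) (D : set R) : measurable D ->
  leb.-integrable D (EFin \o fun s => c * k s).
Proof.
move=> mD; rewrite (_ : _ \o _ = fun s => (c%:E * (EFin \o k) s)%E).
  apply: integrableZl => //; apply: (integrableS measurableT) => //.
  exact: integrable_decay.
by apply/funext => s; rewrite /= EFinM.
Qed.

Lemma integrable_N F M x v : 0 <= M -> jointly_measurable F -> bounded_by F M ->
  leb.-integrable setT (EFin \o fun s => N F s x v).
Proof.
move=> M0 mF FM; apply: (@integrable_le_norm _ _ R leb setT (fun s => N F s x v)
  (fun s => C * M ^+ 5 * w x v * k s)) => //.
- exact: measurable_N_slice.
- exact: integrable_decayZ.
- by move=> s _; exact: norm_N_le.
Qed.

Lemma Rintegral_itvNyc_decay t : \int[leb]_(s in `]-oo, t]) k s = mass + K t.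
Proof. by rewrite /Rintegral integral_itvNyc_decay. Qed.

Lemma pastB F M s t x v : 0 <= M -> jointly_measurable F -> bounded_by F M ->
  s <= t -> past F t x v - past F s x v = \int[leb]_(r in `[s, t]) N F r x v.
Proof.
move=> M0 mF FM st; have iN := integrable_N x v M0 mF FM.
rewrite /past (@Rintegral_itvB _ _ -oo%O (BRight t) s)//.
- rewrite Rintegral_itv_obnd_cbnd//; exact: (integrableS measurableT).
- exact: (integrableS measurableT).
Qed.

Lemma totalB F M t x v : 0 <= M -> jointly_measurable F -> bounded_by F M ->
  total F x v - past F t x v = \int[leb]_(r in `[t, +oo[) N F r x v.
Proof.
move=> M0 mF FM; have iN := integrable_N x v M0 mF FM.
rewrite /total /past -set_itvNyy (@Rintegral_itvB _ _ -oo%O +oo%O t)//.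
- rewrite Rintegral_itv_obnd_cbnd//; exact: (integrableS measurableT).
- exact: (integrableS measurableT).
Qed.

Lemma duhamel_past F M t x v : 0 <= M -> jointly_measurable F -> bounded_by F M ->
  oriented_integral 0 t (fun s => N F s x v) = past F t x v - past F 0 x v.
Proof.
move=> M0 mF FM; rewrite /oriented_integral; case: leP => t0.
  by rewrite (pastB x v M0).
by rewrite -(pastB x v M0 mF FM (ltW t0)) opprB.
Qed.

Lemma jointly_measurable_past F : jointly_measurable F -> jointly_measurable (past F).
Proof.
move=> mF; rewrite /jointly_measurable.
(* The moving endpoint becomes an indicator in the integrand, so that the domain of integration is
   fixed. *)
rewrite (_ : (fun _ => _) = fun p : R * R * R =>
  \int[leb]_s (N F s p.1.2 p.2 * (s <= p.1.1)%R%:R)); last first.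
  apply/funext => p; rewrite /past Rintegral_mkcond; apply: eq_Rintegral => s _.
  by rewrite patchE mem_setE in_itv/=; case: (s <= _); rewrite ?mulr1 ?mulr0.
apply: (@measurable_fun_Rintegral _ _ (R * R * R)%type (measurableTypeR R) R leb setT
  (fun p s => N F s p.1.2 p.2 * (s <= p.1.1)%R%:R)) => //.
have m1 : measurable_fun setT (fun z : (R * R * R) * R => z.1.1.1).
  by apply: measurableT_comp => //; exact: measurableT_comp.
apply: measurable_funM.
  apply: jointly_measurable_comp; first exact: N_measurable; rewrite //.
    by apply: measurableT_comp => //; exact: measurableT_comp.
  exact: measurableT_comp.
rewrite (_ : (fun _ => _) =
  (fun z : (R * R * R) * R => if z.2 <= z.1.1.1 then 1 else 0)); last first.
  by apply/funext => z; case: (_ <= _).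
by apply: measurable_fun_ifT => //; exact: measurable_fun_ler.
Qed.

Lemma past_lipschitz F G M D t x v : 0 <= M -> 0 <= D ->
  jointly_measurable F -> jointly_measurable G ->
  (forall t x v, close (M * w x v) (D * w x v) (F t x v) (G t x v)) ->
  `|past F t x v - past G t x v| <= C * M ^+ 4 * D * w x v * (2 * mass).
Proof.
move=> M0 D0 mF mG FG.
have FM : bounded_by F M by move=> t' x' v'; case: (FG t' x' v').
have GM : bounded_by G M by move=> t' x' v'; case: (FG t' x' v').
have iF := integrable_N x v M0 mF FM.
have iG := integrable_N x v M0 mG GM.
rewrite /past -RintegralB//; try exact: (integrableS measurableT).
apply: (@le_trans _ _ (\int[leb]_(s in `]-oo, t]) (C * M ^+ 4 * D * w x v * k s))).
  apply: norm_Rintegral_le => //.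
  - apply: measurable_funTS; apply: measurable_funB;
      exact: measurable_N_slice.
  - exact: integrable_decayZ.
  - by move=> s _; apply: N_lipschitz.
rewrite RintegralZl//; last exact: (integrableS measurableT _ _ (integrable_decay a0 b0)).
rewrite Rintegral_itvNyc_decay ler_wpM2l//; first by rewrite !mulr_ge0 ?exprn_ge0.
by have /andP[_] := decay_prim_bound a b t; lra.
Qed.

Lemma norm_past_le F M t x v : 0 <= M -> jointly_measurable F -> bounded_by F M ->
  `|past F t x v| <= C * M ^+ 5 * w x v * (mass + K t).
Proof.
move=> M0 mF FM; have iF := integrable_N x v M0 mF FM.
rewrite -Rintegral_itvNyc_decay -RintegralZl//; last first.
  exact: (integrableS measurableT _ _ (integrable_decay a0 b0)).
apply: norm_Rintegral_le => //.
- by apply: measurable_funTS; exact: measurable_N_slice.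
- exact: integrable_decayZ.
- by move=> s _; exact: norm_N_le.
Qed.

Lemma norm_totalB_le F M t x v : 0 <= M -> jointly_measurable F -> bounded_by F M ->
  `|total F x v - past F t x v| <= C * M ^+ 5 * w x v * (mass - K t).
Proof.
move=> M0 mF FM; have iF := integrable_N x v M0 mF FM.
rewrite (totalB _ _ _ M0)//.
have <- : \int[leb]_(s in `[t, +oo[) k s = mass - K t.
  by rewrite /Rintegral integral_itvcy_decay.
rewrite -RintegralZl//; last first.
  exact: (integrableS measurableT _ _ (integrable_decay a0 b0)).
apply: norm_Rintegral_le => //.
- by apply: measurable_funTS; exact: measurable_N_slice.
- exact: integrable_decayZ.
- by move=> s _; exact: norm_N_le.
Qed.

Lemma measurable_total F : jointly_measurable F ->
  measurable_fun setT (fun p : R * R => total F p.1 p.2).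
Proof.
move=> mF; apply: (@measurable_fun_Rintegral _ _ (R * R)%type (measurableTypeR R)
  R leb setT (fun p s => N F s p.1 p.2)) => //.
apply: jointly_measurable_comp; first exact: N_measurable; rewrite //;
  exact: measurableT_comp.
Qed.

(* Gronwall: a bound [S e^{l K}] on the difference with [l > 2 C M^4]
   improves to [S / 2 e^{l K}]; no regularity in time is needed. *)
Lemma duhamel_unique F G M : 0 <= M ->
  jointly_measurable F -> jointly_measurable G ->
  bounded_by F M -> bounded_by G M -> duhamel F -> duhamel G ->
  (forall e, 0 < e -> exists T, forall t, t <= T ->
    forall x v, `|F t x v - G t x v| <= e * w x v) ->
  forall t x v, F t x v = G t x v.
Proof.
move=> M0 mF mG FM GM dF dG FG0.
(* The summand 1 keeps [l] positive when [C * M ^+ 4] is 0. *)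
pose l := 2 * (C * M ^+ 4) + 1.
have CM0 : 0 <= C * M ^+ 4 by rewrite mulr_ge0 ?exprn_ge0.
have l0 : 0 < l by rewrite /l; lra.
pose E t := expR (l * K t).
have E0 t : 0 < E t by exact: expR_gt0.
have increment H s t x v : jointly_measurable H -> bounded_by H M -> duhamel H ->
    s <= t -> H t x v = H s x v + \int[leb]_(r in `[s, t]) N H r x v.
  move=> mH HM dH st; rewrite (dH t) (dH s) -(pastB x v M0 mH HM st).
  by rewrite !(duhamel_past _ _ _ M0 mH HM); ring.
have halve S : 0 <= S -> (forall t x v, `|F t x v - G t x v| <= S * E t * w x v) ->
    forall t x v, `|F t x v - G t x v| <= S / 2 * E t * w x v.
  move=> S0 FGS t x v; apply/ler_addgt0Pr => e e0.
  have w1 : 0 < w x v + 1 by rewrite ltr_wpDl.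
  (* Up to time [T] the difference at [(x, v)] is at most [e], because [w / (w + 1) <= 1]. The
     integral starts at such a time, and [e] is arbitrary, so no initial term survives. *)
  have [T FGT] := FG0 (e / (w x v + 1)) (divr_gt0 e0 w1).
  pose s := Num.min T t.
  have st : s <= t by rewrite ge_min lexx orbT.
  have sT : s <= T by rewrite ge_min lexx.
  have iF := integrable_N x v M0 mF FM.
  have iG := integrable_N x v M0 mG GM.
  rewrite (increment F s t)// (increment G s t)// opprD addrACA -RintegralB//;
    try exact: (integrableS measurableT).
  apply: le_trans (ler_normD _ _) _; rewrite [leRHS]addrC; apply: lerD.
    apply: le_trans (FGT s sT x v) _.
    rewrite mulrAC ler_pdivrMr// ler_wpM2l ?ltW//; lra.
  have cE : continuous (fun r => k r * E r).
    move=> r; apply: cvgM; first exact: continuous_decay.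
    apply: (@cvg_comp _ _ _ (fun r => l * K r) expR); last exact: continuous_expR.
    apply: cvgM; first exact: cvg_cst.
    have [d _] := is_derive_decay_prim a0 b0 r.
    exact/differentiable_continuous/derivable1_diffP.
  have ikE : leb.-integrable `[s, t] (EFin \o fun r => k r * E r).
    apply: continuous_compact_integrable; first exact: segment_compact.
    exact: continuous_subspaceT.
  apply: (@le_trans _ _ (\int[leb]_(r in `[s, t])
      (C * M ^+ 4 * S * w x v * (k r * E r)))).
    apply: norm_Rintegral_le => //.
    - by apply: measurable_funTS; apply: measurable_funB; exact: measurable_N_slice.
    - rewrite (_ : _ \o _ = fun r => ((C * M ^+ 4 * S * w x v)%:E *
        (EFin \o (fun r => k r * E r)%R) r)%E); first exact: integrableZl.
      by apply/funext => r; rewrite /= EFinM.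
    - move=> r _.
      rewrite (_ : C * _ * _ * _ * _ = C * M ^+ 4 * (S * E r) * w x v * k r); last by ring.
      by apply: N_lipschitz => //; rewrite mulr_ge0// ltW.
  rewrite RintegralZl// integral_decay_expR//.
  rewrite -/(E t) -/(E s).
  apply: (@le_trans _ _ (C * M ^+ 4 * S * w x v * (E t / l))).
    rewrite ler_wpM2l ?mulr_ge0 ?exprn_ge0//.
    by rewrite ler_pM2r ?invr_gt0// gerBl ltW.
  rewrite [leLHS](_ : _ = (C * M ^+ 4 / l) * (S * E t * w x v)); last by ring.
  rewrite [leRHS](_ : _ = 2^-1 * (S * E t * w x v)); last by ring.
  apply: ler_wpM2r; first by rewrite !mulr_ge0// ltW.
  by rewrite ler_pdivrMr// /l; lra.
(* Since [K] is at least [- mass], the factor [expR (l * mass)] compensates the smallness of [E] in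
   the far past, and the crude bound [2 * M * w x v] takes the form from which the halving can
   start. *)
pose S0 := 2 * M * expR (l * mass).
have S00 : 0 <= S0 by rewrite !mulr_ge0// expR_ge0.
have iter n t x v : `|F t x v - G t x v| <= S0 / 2 ^+ n * E t * w x v.
  elim: n t x v => [|n IH] t x v.
    rewrite expr0 divr1; apply: (@le_trans _ _ (2 * M * w x v)).
      apply: le_trans (ler_normB _ _) _.
      by have := FM t x v; have := GM t x v; lra.
    rewrite ler_wpM2r// /S0 -mulrA ler_peMr ?mulr_ge0//.
    rewrite -expRD -[leLHS]expR0 ler_expR -mulrDr mulr_ge0 ?(ltW l0)//.
    by have /andP[h _] := decay_prim_bound a b t; lra.
  rewrite exprSr invfM mulrA; apply: halve => //.
  by rewrite divr_ge0// exprn_ge0.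
move=> t x v; apply/eqP; rewrite -subr_eq0; apply/eqP.
apply: (@eq0_le_geometric _ (S0 * E t * w x v)) => n.
by apply: le_trans (iter n t x v) _; rewrite le_eqVlt; apply/orP; left; apply/eqP; ring.
Qed.

Section picard.
(* [fm] is the prescribed state at time [-oo]. *)
Variables (fm : R -> R -> R) (M : R).
Hypothesis M0 : 0 <= M.
Hypothesis mfm : measurable_fun setT (fun p : R * R => fm p.1 p.2).
Hypothesis fmM : forall x v, `|fm x v| <= M / 2 * w x v.
Hypothesis small : C * M ^+ 4 * (2 * mass) <= 2^-1.

Definition picard_step F t x v : R := fm x v + past F t x v.

Definition picard n := iter n picard_step (fun _ _ _ => 0).

Lemma past0 t x v : past (fun _ _ _ => 0) t x v = 0.
Proof.
rewrite /past (@eq_Rintegral _ _ _ _ _ (cst 0)) => [|s _]; last by rewrite N0.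
by rewrite /Rintegral integral0.
Qed.

(** The integral of [k] up to any time is at most [2 * mass], so [small] turns the Lipschitz bound
    for [past] into a contraction factor 1/2. *)
Lemma picard_step_contracts F G D : 0 <= D ->
  jointly_measurable F -> jointly_measurable G ->
  (forall t x v, close (M * w x v) (D * w x v) (F t x v) (G t x v)) ->
  forall t x v, `|picard_step F t x v - picard_step G t x v| <= D / 2 * w x v.
Proof.
move=> D0 mF mG FG t x v; rewrite /picard_step opprD addrACA subrr add0r.
apply: le_trans (past_lipschitz _ _ _ M0 D0 mF mG FG) _.
rewrite [leLHS](_ : _ = C * M ^+ 4 * (2 * mass) * (D * w x v)); last by ring.
rewrite [leRHS](_ : _ = 2^-1 * (D * w x v)); last by ring.
by rewrite ler_wpM2r// mulr_ge0.
Qed.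

(** One half of [M] comes from [fm], the other from contracting the distance of [F] to the zero
    function. *)
Lemma picard_step_bounded F : jointly_measurable F -> bounded_by F M ->
  bounded_by (picard_step F) M.
Proof.
move=> mF FM t x v.
have := @picard_step_contracts F _ M M0 mF jointly_measurable0.
have cF t' x' v' : close (M * w x' v') (M * w x' v') (F t' x' v') 0.
  by split; rewrite ?subr0 ?normr0 ?mulr_ge0//; exact: FM.
move=> /(_ cF t x v); rewrite {2}/picard_step past0 addr0 => h.
rewrite -[picard_step F t x v](subrK (fm x v)); apply: le_trans (ler_normD _ _) _.
by have := fmM x v; lra.
Qed.

Lemma jointly_measurable_picard_step F : jointly_measurable F ->
  jointly_measurable (picard_step F).
Proof.
move=> mF; apply: measurable_funD; last exact: jointly_measurable_past.
have m1 : measurable_fun setT (fun p : R * R * R => p.1.2).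
  by apply: measurableT_comp => //; exact: measurableT_comp.
have m2 : measurable_fun setT (fun p : R * R * R => p.2) by exact: measurable_snd.
exact: (measurableT_comp mfm (measurable_fun_pair m1 m2)).
Qed.

Lemma picard_ok n : jointly_measurable (picard n) /\ bounded_by (picard n) M.
Proof.
elim: n => [|n [mF FM]].
  by split=> [|t x v]; [exact: jointly_measurable0|rewrite normr0 mulr_ge0].
by split; [exact: jointly_measurable_picard_step|exact: picard_step_bounded].
Qed.

Lemma picard_increment n t x v :
  `|picard n.+1 t x v - picard n t x v| <= M / 2 ^+ n.+1 * w x v.
Proof.
elim: n t x v => [|n IH] t x v.
  by rewrite /picard /= subr0 /picard_step past0 addr0 expr1; exact: fmM.
have [m0 b0'] := picard_ok n; have [m1 b1] := picard_ok n.+1.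
rewrite [in leRHS]exprSr invfM mulrA.
apply: picard_step_contracts => //; first by rewrite divr_ge0// exprn_ge0.
by move=> t' x' v'; split; [exact: b1|exact: b0'|exact: IH].
Qed.

Lemma picard_cauchy n m t x v :
  `|picard (n + m) t x v - picard n t x v| <= M * w x v / 2 ^+ n.
Proof.
have h2 i : 0 < 2 ^+ i :> R by rewrite exprn_gt0.
have Mw : 0 <= M * w x v by rewrite mulr_ge0.
(* The subtracted term is the part of the geometric series not yet used; keeping it makes the
   induction on [m] close. *)
suff : `|picard (n + m) t x v - picard n t x v| <=
    M * w x v / 2 ^+ n - M * w x v / 2 ^+ (n + m).
  move=> /le_trans; apply; rewrite gerBl divr_ge0// ltW//.
elim: m => [|m IH]; first by rewrite addn0 !subrr normr0.
rewrite addnS.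
rewrite (_ : _ - _ = (picard (n + m).+1 t x v - picard (n + m) t x v) +
  (picard (n + m) t x v - picard n t x v)); last by ring.
apply: le_trans (ler_normD _ _) _.
have := picard_increment (n + m) t x v; move: IH.
rewrite [in X in _ -> X -> _]mulrAC exprS invfM.
have := h2 (n + m)%N; lra.
Qed.

Definition picard_lim t x v : R := limn (fun n => picard n t x v).

Lemma picard_lim_dist n t x v :
  `|picard_lim t x v - picard n t x v| <= M * w x v / 2 ^+ n.
Proof.
by have [_] := cvg_geometric_cauchy (fun n m => picard_cauchy n m t x v); apply.
Qed.

Lemma jointly_measurable_picard_lim : jointly_measurable picard_lim.
Proof.
apply: (measurable_fun_cvg (h := fun n (p : R * R * R) => picard n p.1.1 p.1.2 p.2)).
  by move=> n; have [] := picard_ok n.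
move=> p _.
by have [] := cvg_geometric_cauchy (fun n m => picard_cauchy n m p.1.1 p.1.2 p.2).
Qed.

Lemma picard_lim_bounded : bounded_by picard_lim M.
Proof. by move=> t x v; have := picard_lim_dist 0 t x v; rewrite expr0 divr1 subr0. Qed.

(** No limit is taken under the integral: both sides lie within [M * w x v / 2 ^+ n.+1] of
    [picard n.+1], the right-hand one by contraction, and [n] is arbitrary. *)
Lemma picard_lim_fixed t x v : picard_lim t x v = fm x v + past picard_lim t x v.
Proof.
apply/eqP; rewrite -subr_eq0; apply/eqP.
apply: (@eq0_le_geometric _ (M * w x v)) => n.
rewrite -[fm x v + _]/(picard_step picard_lim t x v).
rewrite (_ : _ - _ = (picard_lim t x v - picard n.+1 t x v) -
  (picard_step picard_lim t x v - picard n.+1 t x v)); last by ring.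
apply: le_trans (ler_normB _ _) _.
have [mn bn] := picard_ok n.
have h := @picard_step_contracts picard_lim (picard n) (M / 2 ^+ n).
have {}h := h (divr_ge0 M0 (exprn_ge0 n (ler0n _ 2))) jointly_measurable_picard_lim mn.
have cl t' x' v' : close (M * w x' v') (M / 2 ^+ n * w x' v')
    (picard_lim t' x' v') (picard n t' x' v').
  split; [exact: picard_lim_bounded|exact: bn|].
  by rewrite mulrAC; exact: picard_lim_dist.
have {}h := h cl t x v.
have := picard_lim_dist n.+1 t x v; rewrite exprS invfM.
rewrite mulrAC in h; move: h; rewrite -[picard_step (picard n)]/(picard n.+1).
lra.
Qed.

Lemma duhamel_exists : exists F (fp : R -> R -> R),
  [/\ jointly_measurable F, bounded_by F M, duhamel F,
      measurable_fun setT (fun p : R * R => fp p.1 p.2) &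
      (forall x v, `|fp x v| <= M * w x v)] /\
  (forall t x v, `|F t x v - fm x v| <= C * M ^+ 5 * w x v * (mass + K t)) /\
  (forall t x v, `|F t x v - fp x v| <= C * M ^+ 5 * w x v * (mass - K t)).
Proof.
have mF := jointly_measurable_picard_lim; have FM := picard_lim_bounded.
exists picard_lim, (fun x v => fm x v + total picard_lim x v); split; last split.
- split => //.
  + move=> t x v; rewrite (duhamel_past _ _ _ M0 mF FM) !(picard_lim_fixed _ x v).
    by ring.
  + by apply: measurable_funD => //; exact: measurable_total.
  (* Cutting the time line at 0 leaves two pieces with masses [mass + K 0] and [mass - K 0]. They
     add up to [2 * mass], so by [small] the whole interaction contributes at most [M / 2 * w x v],
     as much as the data. *)
  + move=> x v; apply: le_trans (ler_normD _ _) _.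
    have h1 := norm_totalB_le 0 x v M0 mF FM; have h2 := norm_past_le 0 x v M0 mF FM.
    have := ler_normD (total picard_lim x v - past picard_lim 0 x v)
      (past picard_lim 0 x v).
    rewrite subrK => h3.
    have : C * M ^+ 4 * (2 * mass) * (M * w x v) <= 2^-1 * (M * w x v).
      by rewrite ler_wpM2r// mulr_ge0.
    rewrite [leLHS](_ : _ = C * M ^+ 5 * w x v * (mass - K 0) +
      C * M ^+ 5 * w x v * (mass + K 0)); last by ring.
    by have := fmM x v; lra.
- move=> t x v; rewrite picard_lim_fixed [_ + past _ _ _ _]addrC addrK.
  exact: norm_past_le.
- move=> t x v; rewrite picard_lim_fixed opprD addrACA subrr add0r distrC.
  exact: norm_totalB_le.
Qed.

End picard.

End duhamel.

(** * Time reversal *)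

Section time_reversal.
Context {R : realType}.
Notation leb := (@lebesgue_measure R).
Implicit Types (F : R -> R -> R -> R) (N : (R -> R -> R -> R) -> R -> R -> R -> R).

Definition reverse F : R -> R -> R -> R := fun t => F (- t).

(** If [F' = N F], then [reverse F] solves the same kind of equation with this operator; the minus
    sign is the chain rule for [t] replaced by [- t]. *)
Definition reverse_op N : (R -> R -> R -> R) -> R -> R -> R -> R :=
  fun F t x v => - N (reverse F) (- t) x v.

Lemma reverseK F : reverse (reverse F) = F.
Proof. by apply/funext => t; rewrite /reverse opprK. Qed.

Lemma reverse_opK N : reverse_op (reverse_op N) = N.
Proof.
apply/funext => F; apply/funext => t; apply/funext => x; apply/funext => v.
by rewrite /reverse_op reverseK !opprK.
Qed.

Lemma jointly_measurable_reverse F :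
  jointly_measurable F -> jointly_measurable (reverse F).
Proof.
move=> mF; have m1 : measurable_fun setT (fun p : R * R * R => p.1.1).
  by apply: measurableT_comp => //; exact: measurableT_comp.
have m2 : measurable_fun setT (fun p : R * R * R => p.1.2).
  by apply: measurableT_comp => //; exact: measurableT_comp.
apply: (jointly_measurable_comp mF) => //; exact: measurableT_comp.
Qed.

(** The sign disappears in the absolute value, and [decay] is even in time. *)
Lemma tame_reverse_op (a b C : R) (w : R -> R -> R) N :
  tame a b C w N -> tame a b C w (reverse_op N).
Proof.
move=> [Nm Nl N0]; split.
- move=> F mF; apply: measurableT_comp => //.
  exact: (jointly_measurable_reverse (Nm _ (jointly_measurable_reverse mF))).
- move=> F G M D t M0 D0 mF mG FG x v.
  rewrite /reverse_op -opprD normrN -(decayN a b t).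
  apply: Nl => //; try exact: jointly_measurable_reverse.
  by move=> x' v'; rewrite /reverse opprK; exact: FG.
- by move=> t x v; rewrite /reverse_op N0 oppr0.
Qed.

Lemma Rintegral_opp (D : set R) (g : R -> R) : measurable D ->
  leb.-integrable setT (EFin \o g) -> leb.-integrable setT (EFin \o (g \o -%R)) ->
  \int[leb]_(s in -%R @^-1` D) g (- s) = \int[leb]_(s in D) g s.
Proof.
move=> mD ig ign; rewrite /Rintegral; congr fine.
have mopp : measurable_fun setT (-%R : measurableTypeR R -> measurableTypeR R).
  exact: oppr_measurable.
have mg : measurable_fun setT (EFin \o g : measurableTypeR R -> \bar R).
  exact: (measurable_int leb).
have mDo : measurable (-%R @^-1` D : set (measurableTypeR R)).
  by rewrite -[X in measurable X]setTI; exact: mopp.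
rewrite -[LHS](integral_pushforward mopp mg _ mD); last first.
  exact: (integrableS measurableT).
by apply: eq_measure_integral => A mA _; exact: lebesgue_measureN.
Qed.

Lemma oriented_integral_reverse (g : R -> R) (t : R) :
  leb.-integrable setT (EFin \o g) -> leb.-integrable setT (EFin \o (g \o -%R)) ->
  oriented_integral 0 (- t) (fun s => - g (- s)) = oriented_integral 0 t g.
Proof.
move=> ig ign.
have opp (c d : R) : \int[leb]_(s in `[c, d]) - g (- s) =
    - \int[leb]_(s in `[- d, - c]) g s.
  rewrite -(Rintegral_opp _ ig ign)// opp_preimage_itvbndbnd/= !opprK.
  under eq_Rintegral do rewrite -mulN1r.
  by rewrite RintegralZl ?mulN1r//; exact: (integrableS measurableT).
rewrite /oriented_integral oppr_ge0; case: (ltgtP t 0) => [t0|t0|->].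
- by rewrite opp opprK oppr0.
- by rewrite opp oppr0 !opprK.
- by rewrite opp !oppr0 !set_itv1 !Rintegral_set1 oppr0.
Qed.

Lemma duhamel_reverse (a b C : R) (w : R -> R -> R) N F M :
  0 < a -> 0 < b -> (forall x v, 0 <= w x v) -> tame a b C w N ->
  0 <= M -> jointly_measurable F -> bounded_by w F M ->
  duhamel N F -> duhamel (reverse_op N) (reverse F).
Proof.
move=> a0 b0 w0 tN M0 mF FM dF t x v.
have mR := jointly_measurable_reverse mF.
have RM : bounded_by w (reverse F) M by move=> s; exact: FM.
have iN := integrable_N a0 b0 w0 tN x v M0 mF FM.
have iR := integrable_N a0 b0 w0 (tame_reverse_op tN) x v M0 mR RM.
have iRN : leb.-integrable setT (EFin \o ((fun s => N F s x v) \o -%R)).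
  have := integrableN iR; apply: eq_integrable => // s _ /=.
  by rewrite /reverse_op reverseK opprK.
rewrite /reverse /= oppr0 (dF (- t)) -(oriented_integral_reverse _ iN iRN) opprK.
congr (_ + _); congr oriented_integral; apply/funext => s.
by rewrite /reverse_op reverseK.
Qed.

End time_reversal.

(** * The kinetic equation *)

Section interaction_picture.
Context {R : realType} (a b : R).
Hypotheses (a0 : 0 < a) (b0 : 0 < b).
Implicit Types (f F : R -> R -> R -> R) (g : R -> R -> R).

Definition weight (x v : R) : R := expR (- (a * x ^+ 2 + b * v ^+ 2)).

Lemma weight_gt0 x v : 0 < weight x v. Proof. exact: expR_gt0. Qed.

Let weight_ge0 x v : 0 <= weight x v. Proof. exact: expR_ge0. Qed.

Lemma wnorm_leP g (r : R) : 0 <= r ->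
  (wnorm a b g <= r%:E)%E <-> forall x v, `|g x v| <= r * weight x v.
Proof.
move=> r0.
have E x v : (`|g x v| * expR (a * x ^+ 2 + b * v ^+ 2) <= r) =
    (`|g x v| <= r * weight x v).
  by rewrite /weight expRN ler_pdivlMr ?expR_gt0.
split=> [gr x v|gr].
  rewrite -E -lee_fin; apply: le_trans gr.
  by apply: ereal_sup_ubound; exists (x, v).
by apply: ge_ereal_sup => _ [[x v] _ <-]; rewrite lee_fin/= E.
Qed.

Lemma wnorm_ge0 g : (0 <= wnorm a b g)%E.
Proof.
apply: (@le_trans _ _ (`|g 0 0| * expR (a * 0 ^+ 2 + b * 0 ^+ 2))%:E).
  by rewrite lee_fin mulr_ge0// expR_ge0.
by apply: ereal_sup_ubound; exists (0, 0).
Qed.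

Lemma wballP g (r : R) : wball a b r g ->
  measurable_fun setT (fun p : R * R => g p.1 p.2) /\
  forall x v, `|g x v| <= r * weight x v.
Proof.
move=> [[mg _] gr]; split => //; apply/wnorm_leP; last exact: ltW.
by have := le_lt_trans (wnorm_ge0 g) gr; rewrite lte_fin => /ltW.
Qed.

Lemma wballW g (M r : R) : 0 <= M -> M < r ->
  measurable_fun setT (fun p : R * R => g p.1 p.2) ->
  (forall x v, `|g x v| <= M * weight x v) -> wball a b r g.
Proof.
move=> M0 Mr mg gM; have gM' : (wnorm a b g <= M%:E)%E by apply/wnorm_leP.
split; last by apply: le_lt_trans gM' _; rewrite lte_fin.
by split => //; apply: le_lt_trans gM' (ltry _).
Qed.

Lemma jointly_measurable_transport f (s : R -> R) : measurable_fun setT s ->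
  jointly_measurable f -> jointly_measurable (fun t => transport (s t) f t).
Proof.
move=> ms mf.
have m0 : measurable_fun setT (fun p : R * R * R => p.1.1).
  by apply: measurableT_comp => //; exact: measurableT_comp.
have m1 : measurable_fun setT (fun p : R * R * R => p.1.2).
  by apply: measurableT_comp => //; exact: measurableT_comp.
have m2 : measurable_fun setT (fun p : R * R * R => p.2) by exact: measurable_snd.
apply: (jointly_measurable_comp mf) => //.
apply: measurable_funB => //; apply: measurable_funM => //.
exact: (measurableT_comp ms m0).
Qed.

Definition to_interaction f : R -> R -> R -> R := fun t => transport (- t) f t.

Definition of_interaction F : R -> R -> R -> R := fun t => transport t F t.

Lemma to_interactionK f : of_interaction (to_interaction f) = f.
Proof.
apply/funext => t; apply/funext => x; apply/funext => v.
by rewrite /of_interaction /to_interaction /transport; congr f; ring.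
Qed.

Lemma of_interactionK F : to_interaction (of_interaction F) = F.
Proof.
apply/funext => t; apply/funext => x; apply/funext => v.
by rewrite /of_interaction /to_interaction /transport; congr F; ring.
Qed.

Lemma jointly_measurable_to f :
  jointly_measurable f -> jointly_measurable (to_interaction f).
Proof. by apply: jointly_measurable_transport; exact: oppr_measurable. Qed.

Lemma jointly_measurable_of F :
  jointly_measurable F -> jointly_measurable (of_interaction F).
Proof. exact: jointly_measurable_transport. Qed.

Definition wave_op F : R -> R -> R -> R := to_interaction (C6 (of_interaction F)).

Lemma tame_wave_op : tame a b (15 * @ellmass R) weight wave_op.
Proof.
split.
- move=> F mF; apply: jointly_measurable_to; apply: jointly_measurable_C6.
  exact: jointly_measurable_of.
- move=> F G M D t M0 D0 mF mG FG x v; rewrite /wave_op /to_interaction /transport.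
  (* In physical space the particle sits at [y = x + t * v], and the transported weight at [(y, v)]
     is again [weight a b x v]. *)
  pose y := x - (- t) * v; rewrite -/y.
  have gw z : gweight a b t y z = weight (y - t * z) z by [].
  have fg z : close (M * gweight a b t y z) (D * gweight a b t y z)
      (of_interaction F t y z) (of_interaction G t y z).
    by rewrite gw; exact: FG.
  have := norm_C6B_le v a0 b0 M0 D0
    (jointly_measurable_of mF) (jointly_measurable_of mG) fg.
  move=> /le_trans; apply.
  rewrite gw (_ : y - t * v = x); last by rewrite /y; ring.
  by rewrite le_eqVlt; apply/orP; left; apply/eqP; ring.
- move=> t x v; rewrite /wave_op /to_interaction /transport /C6.
  rewrite (@eq_Rintegral _ _ _ _ _ (cst 0)) => [|u _].
    by rewrite /Rintegral integral0.
  rewrite /delta_integral (@eq_Rintegral _ _ _ _ _ (cst 0)) => [|p _].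
    by rewrite /Rintegral integral0.
  by rewrite /of_interaction /transport /six_wave !(mul0r, mulr0, subrr).
Qed.

(** At time 0 the integral runs over a single point, which forces the initial datum to be
    [to_interaction f 0]. The existential over data thus becomes one over a bound [M]. *)
Lemma mild_solutionP f : mild_solution a b f <->
  exists M, [/\ 0 <= M, jointly_measurable (to_interaction f),
    bounded_by weight (to_interaction f) M & duhamel wave_op (to_interaction f)].
Proof.
have opE : wave_op (to_interaction f) = to_interaction (C6 f).
  by rewrite /wave_op to_interactionK.
split=> [[f0 [[mf0 _] mf [mF Fsup] fE]]|[M [M0 mF FM dF]]].
  set S := ereal_sup _ in Fsup.
  have SF t : (wnorm a b (to_interaction f t) <= S)%E.
    by apply: ereal_sup_ubound; exists t.
  clearbody S; have S0 : (0 <= S)%E by apply: le_trans (wnorm_ge0 _) (SF 0).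
  have SE : S = (fine S)%:E by apply/esym/fineK; rewrite (ge0_fin_numE S0).
  exists (fine S); split; [exact: fine_ge0|exact: jointly_measurable_to| |].
    by move=> t; apply/wnorm_leP; [exact: fine_ge0|rewrite -SE; exact: SF].
  have F0 x v : to_interaction f 0 x v = f0 x v.
    have := fE 0 x v; rewrite /to_interaction => ->.
    by rewrite /oriented_integral lexx set_itv1 Rintegral_set1 addr0.
  move=> t x v; rewrite F0 opE; exact: fE.
exists (to_interaction f 0); split.
- have mF0 : measurable_fun setT (fun p : R * R => to_interaction f 0 p.1 p.2).
    by apply: (jointly_measurable_comp mF); [exact: measurable_cst|
      exact: measurable_fst|exact: measurable_snd].
  by have [] := @wballW _ M (M + 1) M0 _ mF0 (FM 0); rewrite ?ltrDl.
- by rewrite -[f]to_interactionK; exact: jointly_measurable_of.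
- split; [exact: mF|apply: (@le_lt_trans _ _ M%:E); last exact: ltry].
  by apply: ge_ereal_sup => _ [t _ <-]; apply/wnorm_leP; [exact: M0|exact: FM].
- by move=> t x v; have := dF t x v; rewrite opE.
Qed.

Lemma scattersP f g (Fl : set_system R) : Filter Fl ->
  scatters a b Fl f g <-> forall e, 0 < e ->
    \forall t \near Fl, forall x v, `|to_interaction f t x v - g x v| <= e * weight x v.
Proof.
move=> FF; pose d t := wnorm a b (fun x v => to_interaction f t x v - g x v).
have dE : scatters a b Fl f g <-> d t @[t --> Fl] --> 0%E by [].
rewrite dE; split=> [d0 e e0|fg].
  have [fin /cvgrPdist_lt /(_ e e0) de] := (fine_cvgP _ _).1 d0.
  near=> t; apply/wnorm_leP; first exact: ltW.
  rewrite -/(d t) -[d t]fineK; last by near: t.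
  have : `|0 - fine (d t)| < e by near: t.
  by rewrite sub0r normrN lee_fin => /ltW; apply: le_trans; exact: ler_norm.
have d_le e : 0 < e -> \forall t \near Fl, (d t <= e%:E)%E.
  move=> e0; apply: filterS (fg e e0) => t ft; apply/wnorm_leP => //; exact: ltW.
apply/fine_cvgP; split.
  apply: filterS (d_le 1 ltr01) => t dt.
  by rewrite ge0_fin_numE ?wnorm_ge0//; exact: le_lt_trans dt (ltry _).
apply/cvgrPdist_le => e e0; apply: filterS (d_le e e0) => t dt.
have d0 : (0 <= d t)%E by exact: wnorm_ge0.
have df : d t \is a fin_num by rewrite ge0_fin_numE//; exact: le_lt_trans dt (ltry _).
rewrite sub0r normrN ger0_norm ?fine_ge0// -lee_fin fineK//.
Unshelve. all: by end_near. Qed.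

Lemma scatters_decay f g (c : R -> R) (B : R) (Fl : set_system R) : Filter Fl ->
  0 <= B -> c t @[t --> Fl] --> 0 ->
  (forall t x v, `|to_interaction f t x v - g x v| <= B * weight x v * c t) ->
  scatters a b Fl f g.
Proof.
move=> FF B0 c0 fc; apply/scattersP => // e e0.
have B1 : 0 < B + 1 by rewrite ltr_wpDl.
have /cvgrPdist_le /(_ _ (divr_gt0 e0 B1)) := c0; apply: filterS => t.
rewrite sub0r normrN => ct x v; apply: le_trans (fc t x v) _.
rewrite mulrAC ler_wpM2r//.
have : B * c t <= B * (e / (B + 1)).
  by rewrite ler_wpM2l// (le_trans (ler_norm _)).
move=> /le_trans; apply; rewrite mulrCA ler_piMr ?(ltW e0)//.
by rewrite ler_pdivrMr// mul1r; lra.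
Qed.

Lemma scatters_unique f g h (Fl : set_system R) : ProperFilter Fl ->
  scatters a b Fl f g -> scatters a b Fl f h -> g = h.
Proof.
move=> FF /scattersP fg /scattersP fh.
apply/funext => x; apply/funext => v; apply/eqP; rewrite -subr_eq0 -normr_eq0.
rewrite eq_le normr_ge0 andbT; apply/ler_addgt0Pr => e e0; rewrite add0r.
have e2 : 0 < e / 2 / weight x v by rewrite !divr_gt0// weight_gt0.
have [t [ft gt]] := filter_ex (filterI (fg _ e2) (fh _ e2)).
have {}ft := ft x v; have {}gt := gt x v.
rewrite divfK ?gt_eqF ?weight_gt0// in ft gt.
rewrite (_ : _ - _ = (to_interaction f t x v - h x v) -
  (to_interaction f t x v - g x v)); last by ring.
by apply: le_trans (ler_normB _ _) _; lra.
Qed.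

End interaction_picture.

(** * Existence and uniqueness of scattering solutions *)

Section scattering.
Context {R : realType} (a b : R).
Hypotheses (a0 : 0 < a) (b0 : 0 < b).
Implicit Types (f F : R -> R -> R -> R) (g : R -> R -> R).

Let w0 x v : 0 <= weight a b x v. Proof. exact: expR_ge0. Qed.
Let tN := tame_wave_op a0 b0.
Let C0 : 0 <= 15 * @ellmass R. Proof. by rewrite mulr_ge0// ellmass_ge0. Qed.

Lemma bounded_by_le F (M M' : R) : M <= M' ->
  bounded_by (weight a b) F M -> bounded_by (weight a b) F M'.
Proof. by move=> MM FM t x v; apply: le_trans (FM t x v) _; rewrite ler_wpM2r. Qed.

(** The two solutions come with unrelated bounds, neither tied to the data; the Gronwall argument
    runs with the larger one. Convergence to the same [g] supplies its condition in the far past. *)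
Lemma mild_solution_unique_Ny f f' g :
  mild_solution a b f -> mild_solution a b f' ->
  scatters a b -oo f g -> scatters a b -oo f' g -> f = f'.
Proof.
move=> /mild_solutionP[M [M0 mF FM dF]] /mild_solutionP[M' [M0' mF' FM' dF']].
move=> /scattersP fg /scattersP fg'.
rewrite -[f]to_interactionK -[f']to_interactionK; congr of_interaction.
apply/funext => t; apply/funext => x; apply/funext => v.
apply: (@duhamel_unique _ a b _ (weight a b) (@wave_op R) a0 b0 C0 w0 tN
  _ _ (Num.max M M')) => //.
- by rewrite le_max M0.
- by apply: bounded_by_le FM; rewrite le_max lexx.
- by apply: bounded_by_le FM'; rewrite le_max lexx orbT.
move=> e e0; have e2 : 0 < e / 2 by rewrite divr_gt0.
have [T [_ HT]] := filterI (fg _ e2) (fg' _ e2).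
(* Neighborhoods of [-oo] contain strict half-lines [t < T], whereas a condition for all [t <= T] is
   wanted; hence the shift by 1. *)
exists (T - 1) => s sT x' v'; have [] := HT s; first by lra.
move=> /(_ x' v') h /(_ x' v') h'.
rewrite (_ : _ - _ = (to_interaction f s x' v' - g x' v') -
  (to_interaction f' s x' v' - g x' v')); last by ring.
by apply: le_trans (ler_normB _ _) _; lra.
Qed.

Lemma mild_solution_unique_y f f' g :
  mild_solution a b f -> mild_solution a b f' ->
  scatters a b +oo f g -> scatters a b +oo f' g -> f = f'.
Proof.
move=> /mild_solutionP[M [M0 mF FM dF]] /mild_solutionP[M' [M0' mF' FM' dF']].
move=> /scattersP fg /scattersP fg'.
rewrite -[f]to_interactionK -[f']to_interactionK; congr of_interaction.
apply: (can_inj (@reverseK R)).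
apply/funext => t; apply/funext => x; apply/funext => v.
have dR := duhamel_reverse a0 b0 w0 tN M0 mF FM dF.
have dR' := duhamel_reverse a0 b0 w0 tN M0' mF' FM' dF'.
apply: (@duhamel_unique _ a b _ (weight a b) (reverse_op (@wave_op R)) a0 b0 C0 w0
  (tame_reverse_op tN) _ _ (Num.max M M')) => //.
- by rewrite le_max M0.
- exact: jointly_measurable_reverse.
- exact: jointly_measurable_reverse.
- by move=> s; apply: (bounded_by_le _ FM); rewrite le_max lexx.
- by move=> s; apply: (bounded_by_le _ FM'); rewrite le_max lexx orbT.
move=> e e0; have e2 : 0 < e / 2 by rewrite divr_gt0.
have [T [_ HT]] := filterI (fg _ e2) (fg' _ e2).
exists (- T - 1) => s sT x' v'; have [] := HT (- s); first by lra.
move=> /(_ x' v') h /(_ x' v') h'.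
rewrite /reverse (_ : _ - _ = (to_interaction f (- s) x' v' - g x' v') -
  (to_interaction f' (- s) x' v' - g x' v')); last by ring.
by apply: le_trans (ler_normB _ _) _; lra.
Qed.

Lemma cvgNy_past_mass : decay_mass a b + decay_prim a b t @[t --> -oo] --> 0.
Proof.
rewrite -[X in _ --> X](subrr (decay_mass a b)); apply: cvgD; first exact: cvg_cst.
exact: cvgNy_decay_prim.
Qed.

Lemma cvgy_future_mass : decay_mass a b - decay_prim a b t @[t --> +oo] --> 0.
Proof.
rewrite -[X in _ --> X](subrr (decay_mass a b)); apply: cvgB; first exact: cvg_cst.
exact: cvgy_decay_prim.
Qed.

Lemma of_interaction_mild F M : 0 <= M -> jointly_measurable F ->
  bounded_by (weight a b) F M -> duhamel (@wave_op R) F ->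
  mild_solution a b (of_interaction F).
Proof.
by move=> M0 mF FM dF; apply/mild_solutionP; exists M; rewrite of_interactionK.
Qed.

Variable Rs : R.
Hypothesis Rs0 : 0 < Rs.
Hypothesis small : 15 * @ellmass R * Rs ^+ 4 * (2 * decay_mass a b) <= 2^-1.

Let B := 15 * @ellmass R * Rs ^+ 5.
Let Rs_lt : Rs < 2 * Rs. Proof. by move: Rs0; lra. Qed.

Let B0 : 0 <= B. Proof. by rewrite mulr_ge0 ?exprn_ge0// ltW. Qed.

Lemma scattering_forward fm : wball a b (Rs / 2) fm ->
  exists! fpf : (R -> R -> R) * (R -> R -> R -> R),
    [/\ wball a b (2 * Rs) fpf.1, mild_solution a b fpf.2,
        scatters a b +oo fpf.2 fpf.1 & scatters a b -oo fpf.2 fm].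
Proof.
move=> /wballP[mfm fmM].
(* With [M = Rs], the bound on the data is exactly [M / 2]. The resulting state [fp] has norm at
   most [Rs], which leaves strict room in the open ball of radius [2 * Rs]. *)
have [F [fp [[mF FM dF mfp fpM] [hNy hy]]]] :=
  duhamel_exists a0 b0 C0 w0 tN (ltW Rs0) mfm fmM small.
have sNy : scatters a b -oo (of_interaction F) fm.
  apply: (scatters_decay _ B0 cvgNy_past_mass); by rewrite of_interactionK.
have sy : scatters a b +oo (of_interaction F) fp.
  apply: (scatters_decay _ B0 cvgy_future_mass); by rewrite of_interactionK.
have mild := of_interaction_mild (ltW Rs0) mF FM dF.
exists (fp, of_interaction F); split => [|[fp' f'] [/= _ mild' sy' sNy']].
  by split => //=; apply: (wballW (ltW Rs0) Rs_lt mfp fpM).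
(* The state at [-oo] determines the solution, and the solution determines its limit at [+oo]. *)
have ff := mild_solution_unique_Ny mild mild' sNy sNy'.
by move: sy'; rewrite -ff => sy'; rewrite (scatters_unique _ sy sy').
Qed.

Lemma scattering_backward gp : wball a b (Rs / 2) gp ->
  exists! gmg : (R -> R -> R) * (R -> R -> R -> R),
    [/\ wball a b (2 * Rs) gmg.1, mild_solution a b gmg.2,
        scatters a b +oo gmg.2 gp & scatters a b -oo gmg.2 gmg.1].
Proof.
move=> /wballP[mgp gpM].
have tR := tame_reverse_op tN.
have [G [gm [[mG GM dG mgm gmM] [hy hNy]]]] :=
  duhamel_exists a0 b0 C0 w0 tR (ltW Rs0) mgp gpM small.
have mF := jointly_measurable_reverse mG.
have FM : bounded_by (weight a b) (reverse G) Rs by move=> t; exact: GM.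
have dF := duhamel_reverse a0 b0 w0 tR (ltW Rs0) mG GM dG.
rewrite reverse_opK in dF.
have sNy : scatters a b -oo (of_interaction (reverse G)) gm.
  apply: (scatters_decay _ B0 cvgNy_past_mass) => t x v; rewrite of_interactionK.
  by rewrite -[decay_prim a b t]opprK -decay_primN; exact: hNy.
have sy : scatters a b +oo (of_interaction (reverse G)) gp.
  apply: (scatters_decay _ B0 cvgy_future_mass) => t x v; rewrite of_interactionK.
  by rewrite -decay_primN; exact: hy.
have mild := of_interaction_mild (ltW Rs0) mF FM dF.
exists (gm, of_interaction (reverse G)); split => [|[gm' g'] [/= _ mild' sy' sNy']].
  by split => //=; apply: (wballW (ltW Rs0) Rs_lt mgm gmM).
have gg := mild_solution_unique_y mild mild' sy sy'.
by move: sNy'; rewrite -gg => sNy'; rewrite (scatters_unique _ sNy sNy').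
Qed.

End scattering.

(** The fourth power of the hypothesis reads [2^14 * c * r^4 <= sqrt a]: the exponents 7/2, 1/4 and
    1/8 become 14, 1 and 1/2. On the other side [2 * decay_mass a b] is [pi^2 / sqrt (a * b)], so
    [sqrt a] cancels and only [1 / sqrt b] has to be absorbed. The number [2^14 * 2^(-1/2)] left
    over exceeds the required 2 by a wide margin. *)
Lemma decay_mass_small (R : realType) (C a b r : R) :
  0 <= C -> 0 < a -> 0 < b -> 0 < r ->
  r <= a `^ 8^-1 / (2 `^ (7 / 2) * C1beta (C * pi ^+ 2 + 1) b `^ 4^-1) ->
  C * r ^+ 4 * (2 * decay_mass a b) <= 2^-1.
Proof.
move=> C0 a0 b0 r0; set c := C1beta _ _ => rc.
have C10 : 0 < C * pi ^+ 2 + 1 by rewrite ltr_wpDl// mulr_ge0// sqr_ge0.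
have h2 : 2^-1 <= 2 `^ (- 2^-1) :> R.
  by rewrite -[leLHS]powR_inv1// ler_powR//; lra.
have c0 : 0 < c.
  rewrite /c /C1beta !mulr_gt0 ?powR_gt0//.
  by rewrite addr_gt0// invr_gt0.
have pow4 (x y : R) : (x `^ y) ^+ 4 = x `^ (y * 4).
  by rewrite -powR_mulrn ?powR_ge0// -powRrM.
have r4 : r ^+ 4 * (2 ^+ 14 * c) <= Num.sqrt a.
  have d0 : 0 < 2 `^ (7 / 2) * c `^ 4^-1 by rewrite mulr_gt0 ?powR_gt0.
  rewrite ler_pdivlMr// in rc.
  have : (r * (2 `^ (7 / 2) * c `^ 4^-1)) ^+ 4 <= (a `^ 8^-1) ^+ 4.
    by rewrite ler_pXn2r// nnegrE ?powR_ge0// mulr_ge0// ltW.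
  rewrite !exprMn !pow4 (_ : 7 / 2 * 4 = 14%:R :> R); last by field.
  rewrite (_ : 4^-1 * 4 = 1 :> R); last by field.
  rewrite (_ : 8^-1 * 4 = 2^-1 :> R); last by field.
  by rewrite powR_mulrn// (powRr1 (ltW c0)) (powR12_sqrt (ltW a0)).
have sa : 0 < Num.sqrt a by rewrite sqrtr_gt0.
have sb : 0 < Num.sqrt b by rewrite sqrtr_gt0.
have sb2 : Num.sqrt b ^+ 2 = b by rewrite sqr_sqrtr// ltW.
(* The factor [b^-1 + 1] of [C1beta] dominates [1 / sqrt b] both for small and for large [b]. *)
have b2 : 1 <= Num.sqrt b * (b^-1 + 1).
  rewrite -[X in X^-1]sb2 (_ : _ * _ = (Num.sqrt b)^-1 + Num.sqrt b); last first.
    by field; rewrite gt_eqF.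
  have [s1|s1] := leP 1 (Num.sqrt b).
    by rewrite ler_wpDl// invr_ge0 ltW.
  by rewrite ler_wpDr ?(ltW sb)// invf_ge1// ltW.
have -> : C * r ^+ 4 * (2 * decay_mass a b) =
    C * pi ^+ 2 * r ^+ 4 / (Num.sqrt a * Num.sqrt b).
  rewrite /decay_mass sqrtrM ?ltW//; field.
  by rewrite !gt_eqF.
rewrite ler_pdivrMr ?mulr_gt0//.
have rC : 0 <= C * pi ^+ 2 * r ^+ 4.
  by rewrite !mulr_ge0 ?exprn_ge0 ?pi_ge0 ?(ltW r0).
have h14 : 2 <= 2 ^+ 14 * 2 `^ (- 2^-1) :> R.
  apply: (@le_trans _ _ (2 ^+ 14 * 2^-1)); last by rewrite ler_wpM2l ?exprn_ge0.
  by rewrite (exprSr 2 13) mulfK ?ler_eXnr ?ler1n.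
have r40 : 0 < r ^+ 4 by rewrite exprn_gt0.
have : 2 * (C * pi ^+ 2 * r ^+ 4) * 1 <= (2 ^+ 14 * 2 `^ (- 2^-1)) *
    ((C * pi ^+ 2 + 1) * r ^+ 4) * (Num.sqrt b * (b^-1 + 1)).
  apply: ler_pM => //; first by rewrite mulr_ge0.
  by apply: ler_pM => //; rewrite ler_pM2r// lerDl.
have : r ^+ 4 * (2 ^+ 14 * c) * Num.sqrt b <= Num.sqrt a * Num.sqrt b.
  by rewrite ler_pM2r.
rewrite (_ : r ^+ 4 * (2 ^+ 14 * c) * Num.sqrt b = (2 ^+ 14 * 2 `^ (- 2^-1)) *
    ((C * pi ^+ 2 + 1) * r ^+ 4) * (Num.sqrt b * (b^-1 + 1))); last first.
  by rewrite /c /C1beta; ring.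
lra.
Qed.

Theorem theorem2p9 (R : realType) :
  exists C1 : R, 0 < C1 /\
    forall alpha beta Rs : R, 0 < alpha -> 0 < beta -> 0 < Rs ->
      Rs <= alpha `^ 8^-1 / (2 `^ (7 / 2) * C1beta C1 beta `^ 4^-1) ->
      (forall fm : R -> R -> R, wball alpha beta (Rs / 2) fm ->
         exists! fpf : (R -> R -> R) * (R -> R -> R -> R),
           [/\ wball alpha beta (2 * Rs) fpf.1,
               mild_solution alpha beta fpf.2,
               scatters alpha beta +oo fpf.2 fpf.1 &
               scatters alpha beta -oo fpf.2 fm]) /\
      (forall gp : R -> R -> R, wball alpha beta (Rs / 2) gp ->
         exists! gmg : (R -> R -> R) * (R -> R -> R -> R),
           [/\ wball alpha beta (2 * Rs) gmg.1,
               mild_solution alpha beta gmg.2,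
               scatters alpha beta +oo gmg.2 gp &
               scatters alpha beta -oo gmg.2 gmg.1]).
Proof.
have C0 : 0 <= 15 * @ellmass R by rewrite mulr_ge0// ellmass_ge0.
(* Here [15 * ellmass] is the Lipschitz constant of the collision operator and [pi ^+ 2] comes from
   the time integral of [decay]; adding 1 makes positivity independent of [ellmass]. *)
exists (15 * @ellmass R * pi ^+ 2 + 1); split.
  by rewrite ltr_wpDl// mulr_ge0// sqr_ge0.
move=> a b Rs a0 b0 Rs0 Rsle; have small := decay_mass_small C0 a0 b0 Rs0 Rsle.
by split=> h hball; [exact: scattering_forward|exact: scattering_backward].
Qed.
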